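(* The functor $\#:\mathrm{Sp}\times\mathrm{Sp}\to\mathrm{Sp}$ (Heisenberg product of species), together with the natural associativity constraint and the unit object $\mathbf 1$, endows the category $\mathrm{Sp}$ of species with an additive monoidal structure.
   Context: Let $\Bbbk$ be a field of characteristic zero. Let $\mathrm{Set}^{\times}$ be the category of finite sets with bijections as morphisms and $\mathrm{Vect}$ the category of $\Bbbk$-vector spaces. A species is a functor $\mathbf p:\mathrm{Set}^\times\to\mathrm{Vect}$; $\mathrm{Sp}$ is the (abelian) category of species with natural transformations as morphisms. The value of $\mathbf p$ on a finite set $I$ is denoted $\mathbf p[I]$, and its value on a bijection $f$ is denoted $\mathbf p[f]$. The Heisenberg product of species $\mathbf p,\mathbf q$ is the species given on a finite set $I$ by $$(\mathbf p\#\mathbf q)[I]=\bigoplus_{I=S\cup T}\mathbf p[S]\otimes\mathbf q[T],$$ the sum being over all ordered pairs $(S,T)$ of (not necessarily disjoint) subsets of $I$ with $S\cup T=I$. For a bijection $f:I\to J$, the map $(\mathbf p\#\mathbf q)[f]$ is induced by the maps $\mathbf p[f|_S]\otimes\mathbf q[f|_T]:\mathbf p[S]\otimes\mathbf q[T]\to\mathbf p[f(S)]\otimes\mathbf q[f(T)]$. The species $\mathbf 1$ is defined by $\mathbf 1[\emptyset]=\Bbbk$ and $\mathbf 1[I]=0$ for $I\ne\emptyset$. The natural associativity constraint is the one obtained by identifying, through the canonical isomorphisms for tensor products and direct sums of vector spaces, both $((\mathbf p\#\mathbf q)\#\mathbf r)[I]$ and $(\mathbf p\#(\mathbf q\#\mathbf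 r))[I]$ with $\bigoplus_{I=U\cup V\cup W}\mathbf p[U]\otimes\mathbf q[V]\otimes\mathbf r[W]$. An additive monoidal structure is a monoidal structure on an additive category whose product is additive in each variable. *)

(* Defs.v *)
From HB Require Import structures.
From mathcomp Require Import all_boot ssralg matrix.
From mathcomp Require Import sesquilinear generic_quotient ring_quotient.
From mathcomp Require Import boolp.
From mathcomp Require Import finmap monalg.

Set Implicit Arguments.
Unset Strict Implicit.
Unset Printing Implicit Defensive.

Import GRing.Theory.
Local Open Scope ring_scope.
Local Open Scope quotient_scope.

Record category := Category {
  obj :> Type;
  hom : obj -> obj -> Type;
  idc : forall x, hom x x;
  compc : forall x y z, hom y z -> hom x y -> hom x z;
  comp1c : forall x y (f : hom x y), compc (idc y) f = f;
  compc1 : forall x y (f : hom x y), compc f (idc x) = f;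
  compcA : forall x y z t (h : hom z t) (g : hom y z) (f : hom x y),
    compc h (compc g f) = compc (compc h g) f
}.
Arguments hom {_} _ _.
Arguments idc {_} _.
Arguments compc {_ _ _ _} _ _.

Declare Scope cat_scope.
Delimit Scope cat_scope with cat.
Notation "g ∘ f" := (compc g f)
  (at level 40, left associativity) : cat_scope.

Definition is_iso (C : category) (x y : C) (f : hom x y) : Prop :=
  exists g : hom y x, (g ∘ f = idc x)%cat /\ (f ∘ g = idc y)%cat.

Record functor (C D : category) := Functor {
  fobj :> C -> D;
  fmap : forall x y : C, hom x y -> hom (fobj x) (fobj y);
  fmap1 : forall x, fmap (idc x) = idc (fobj x);
  fmapM : forall x y z (g : hom y z) (f : hom x y),
    fmap (g ∘ f)%cat = (fmap g ∘ fmap f)%cat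
}.
Arguments fmap {_ _} _ {_ _} _.

Record nat_trans (C D : category) (F G : functor C D) := NatTrans {
  component :> forall x : C, hom (F x) (G x);
  naturality : forall x y (f : hom x y),
    (component y ∘ fmap F f = fmap G f ∘ component x)%cat
}.

Lemma nat_transP (C D : category) (F G : functor C D) (s t : nat_trans F G) :
  (forall x, s x = t x) -> s = t.
Proof.
case: s t => [s sn] [t tn] /= st.
have {}st : s = t by apply: functional_extensionality_dep.
by subst t; congr NatTrans; apply: Prop_irrelevance.
Qed.

Section FunctorCategory.
Variables C D : category.
Implicit Types F G H : functor C D.

Lemma nat_id_subproof F x y (f : hom x y) :
  (idc (F y) ∘ fmap F f = fmap F f ∘ idc (F x))%cat.
Proof. by rewrite comp1c compc1. Qed.
Definition nat_id F : nat_trans F F := NatTrans (@nat_id_subproof F).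

Lemma nat_comp_subproof F G H (t : nat_trans G H) (s : nat_trans F G)
  x y (f : hom x y) :
  ((t y ∘ s y) ∘ fmap F f = fmap H f ∘ (t x ∘ s x))%cat.
Proof. by rewrite -compcA naturality !compcA naturality. Qed.
Definition nat_comp F G H (t : nat_trans G H) (s : nat_trans F G) :
  nat_trans F H := NatTrans (@nat_comp_subproof F G H t s).

Definition functor_category : category.
Proof.
refine (@Category (functor C D) (@nat_trans C D) nat_id nat_comp _ _ _).
- by move=> F G s; apply: nat_transP => x /=; rewrite comp1c.
- by move=> F G s; apply: nat_transP => x /=; rewrite compc1.
- by move=> *; apply: nat_transP => x /=; rewrite compcA.
Defined.

End FunctorCategory.

Definition product_category (C D : category) : category.
Proof.
refine (@Category (C * D)%type (fun x y => (hom x.1 y.1 * hom x.2 y.2)%type)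
  (fun x => (idc x.1, idc x.2))
  (fun x y z g f => ((g.1 ∘ f.1)%cat, (g.2 ∘ f.2)%cat)) _ _ _).
- by move=> x y [f g] /=; rewrite !comp1c.
- by move=> x y [f g] /=; rewrite !compc1.
- by move=> *; rewrite !compcA.
Defined.

Record additive_category := AdditiveCategory {
  acat :> category;
  zeroh : forall x y : acat, hom x y;
  opph : forall x y : acat, hom x y -> hom x y;
  addh : forall x y : acat, hom x y -> hom x y -> hom x y;
  addhA : forall x y, associative (@addh x y);
  addhC : forall x y, commutative (@addh x y);
  add0h : forall x y, left_id (zeroh x y) (@addh x y);
  addNh : forall x y, left_inverse (zeroh x y) (@opph x y) (@addh x y);
  compc_addl : forall x y z (g g' : hom y z) (f : hom x y),
    (addh g g' ∘ f = addh (g ∘ f) (g' ∘ f))%cat;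
  compc_addr : forall x y z (g : hom y z) (f f' : hom x y),
    (g ∘ addh f f' = addh (g ∘ f) (g ∘ f'))%cat;
  has_zero_object : exists o : acat, forall x,
    (forall f : hom x o, f = zeroh x o) /\ (forall f : hom o x, f = zeroh o x);
  has_biproducts : forall x y : acat, exists (b : acat)
      (i1 : hom x b) (i2 : hom y b) (p1 : hom b x) (p2 : hom b y),
    [/\ (p1 ∘ i1 = idc x)%cat, (p2 ∘ i2 = idc y)%cat,
        (p1 ∘ i2 = zeroh y x)%cat, (p2 ∘ i1 = zeroh x y)%cat
      & addh (i1 ∘ p1)%cat (i2 ∘ p2)%cat = idc b]
}.
Arguments zeroh {_} _ _.
Arguments addh {_ _ _} _ _.

Section Monoidal.
Variables (C : category) (T : functor (product_category C C) C) (e : C).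

Local Notation "x ⊠ y" := (T (x, y)) (at level 38, left associativity).
Local Notation "f ⧆ g" := (@fmap _ _ T (_, _) (_, _) (f, g))
  (at level 38, left associativity).

Record monoidal_structure := MonoidalStructure {
  associator : forall x y z : C, hom ((x ⊠ y) ⊠ z) (x ⊠ (y ⊠ z));
  left_unitor : forall x : C, hom (e ⊠ x) x;
  right_unitor : forall x : C, hom (x ⊠ e) x;
  associator_iso : forall x y z, is_iso (associator x y z);
  left_unitor_iso : forall x, is_iso (left_unitor x);
  right_unitor_iso : forall x, is_iso (right_unitor x);
  associator_natural : forall x y z x' y' z'
      (f : hom x x') (g : hom y y') (h : hom z z'),
    (associator x' y' z' ∘ ((f ⧆ g) ⧆ h)
     = (f ⧆ (g ⧆ h)) ∘ associator x y z)%cat;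
  left_unitor_natural : forall x x' (f : hom x x'),
    (left_unitor x' ∘ (idc e ⧆ f) = f ∘ left_unitor x)%cat;
  right_unitor_natural : forall x x' (f : hom x x'),
    (right_unitor x' ∘ (f ⧆ idc e) = f ∘ right_unitor x)%cat;
  pentagon : forall x y z t,
    (associator x y (z ⊠ t) ∘ associator (x ⊠ y) z t
     = (idc x ⧆ associator y z t) ∘ associator x (y ⊠ z) t
         ∘ (associator x y z ⧆ idc t))%cat;
  triangle : forall x y,
    ((idc x ⧆ left_unitor y) ∘ associator x e y = right_unitor x ⧆ idc y)%cat
}.

End Monoidal.

Record additive_monoidal_structure (C : additive_category)
    (T : functor (product_category C C) C) (e : C) := AdditiveMonoidal {
  monoidal_of_additive :> monoidal_structure T e;
  tensor_additivel : forall (x x' y : C) (f g : hom x x'),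
    @fmap _ _ T (x, y) (x', y) (addh f g, idc y)
    = addh (@fmap _ _ T (x, y) (x', y) (f, idc y))
           (@fmap _ _ T (x, y) (x', y) (g, idc y));
  tensor_additiver : forall (x y y' : C) (f g : hom y y'),
    @fmap _ _ T (x, y) (x, y') (idc x, addh f g)
    = addh (@fmap _ _ T (x, y) (x, y') (idc x, f))
           (@fmap _ _ T (x, y) (x, y') (idc x, g))
}.

Record finbij (I J : finType) := FinBij {
  finbij_fun :> I -> J;
  finbij_bij : bijective finbij_fun
}.

Lemma finbijP (I J : finType) (f g : finbij I J) : f =1 g -> f = g.
Proof.
case: f g => [f fb] [g gb] /= /funext fg; subst g.
by congr FinBij; apply: Prop_irrelevance.
Qed.

Definition finbij_id (I : finType) : finbij I I :=
  FinBij (Bijective (g := id) (frefl _) (frefl _) : bijective (@id I)).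

Definition finbij_comp (I J K : finType) (g : finbij J K) (f : finbij I J) :
  finbij I K := FinBij (bij_comp (finbij_bij g) (finbij_bij f)).

Definition FinBijCat : category.
Proof.
refine (@Category finType finbij finbij_id finbij_comp _ _ _).
- by move=> *; apply: finbijP.
- by move=> *; apply: finbijP.
- by move=> *; apply: finbijP.
Defined.

Definition subfin (I : finType) (S : {set I}) : finType := {x : I | x \in S}.

Definition subval (I : finType) (S : {set I}) (x : subfin S) : I := proj1_sig x.

Lemma subval_inj (I : finType) (S : {set I}) : injective (@subval I S).
Proof. exact: val_inj. Qed.

Section Restriction.
Variables (I J : finType) (f : I -> J) (f_inj : injective f) (S : {set I}).

Definition restr_fun (x : subfin S) : subfin (f @: S) :=
  exist _ (f (subval x)) (imset_f f (proj2_sig x)).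

Lemma restr_bij : bijective restr_fun.
Proof.
apply: inj_card_bij => [x y /(congr1 val) /= /f_inj /val_inj //|].
by rewrite !card_sig (eq_card (B := f @: S)) // card_imset.
Qed.

Definition restr : finbij (subfin S) (subfin (f @: S)) := FinBij restr_bij.

End Restriction.

Section VectorSpaces.
Variable k : fieldType.
Implicit Types U V W : lmodType k.

Lemma linear_funP U V (f g : {linear U -> V}) : f =1 g -> f = g.
Proof.
case: f g => [f [[f1] [f2]]] [g [[g1] [g2]]] /= /funext fg; subst g.
by rewrite (Prop_irrelevance f1 g1) (Prop_irrelevance f2 g2).
Qed.

Definition lin_id U : {linear U -> U} := idfun.
Definition lin_comp U V W (g : {linear V -> W}) (f : {linear U -> V}) :
  {linear U -> W} := g \o f.
Lemma lin_compE U V W (g : {linear V -> W}) (f : {linear U -> V}) x :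
  lin_comp g f x = g (f x).
Proof. by []. Qed.
Definition mk_linear U V (f : U -> V) (f_lin : linear f) : {linear U -> V} :=
  HB.pack f (GRing.isLinear.Build k U V *:%R f f_lin).
Definition lin_zero U V : {linear U -> V} := \0.
Definition lin_opp U V (f : {linear U -> V}) : {linear U -> V} := \- f.
Definition lin_add U V (f g : {linear U -> V}) : {linear U -> V} := f \+ g.

Definition VectCat : category.
Proof.
refine (@Category (lmodType k) (fun U V => {linear U -> V}) lin_id lin_comp _ _ _).
- by move=> *; apply: linear_funP.
- by move=> *; apply: linear_funP.
- by move=> *; apply: linear_funP.
Defined.

(* A direct sum over a finite index type is realised as the space of families. *)
Section Families.
Variables (I : finType) (V : I -> lmodType k).

Definition families : Type := forall i, V i.

HB.instance Definition _ := gen_eqMixin families.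
HB.instance Definition _ := gen_choiceMixin families.

Let fadd (x y : families) : families := fun i => x i + y i.
Let fzero : families := fun i => 0.
Let fopp (x : families) : families := fun i => - x i.
Let fscale (a : k) (x : families) : families := fun i => a *: x i.

Lemma familiesP (x y : families) : (forall i, x i = y i) -> x = y.
Proof. exact: functional_extensionality_dep. Qed.

Let faddA : associative fadd.
Proof. by move=> x y z; apply: familiesP => i; apply: addrA. Qed.
Let faddC : commutative fadd.
Proof. by move=> x y; apply: familiesP => i; apply: addrC. Qed.
Let fadd0 : left_id fzero fadd.
Proof. by move=> x; apply: familiesP => i; apply: add0r. Qed.
Let faddN : left_inverse fzero fopp fadd.
Proof. by move=> x; apply: familiesP => i; apply: addNr. Qed.

HB.instance Definition _ := GRing.isZmodule.Build families faddA faddC fadd0 faddN.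

Let fscaleA a b x : fscale a (fscale b x) = fscale (a * b) x.
Proof. by apply: familiesP => i; apply: scalerA. Qed.
Let fscale1 : left_id 1 fscale.
Proof. by move=> x; apply: familiesP => i; apply: scale1r. Qed.
Let fscaleDr : right_distributive fscale +%R.
Proof. by move=> a x y; apply: familiesP => i; apply: scalerDr. Qed.
Let fscaleDl x : {morph fscale^~ x : a b / a + b}.
Proof. by move=> a b; apply: familiesP => i; apply: scalerDl. Qed.

HB.instance Definition _ :=
  GRing.Zmodule_isLmodule.Build k families fscaleA fscale1 fscaleDr fscaleDl.

Lemma families_proj_linear i : linear (fun x : families => x i).
Proof. by []. Qed.
Definition families_proj i : {linear families -> V i} :=
  mk_linear (@families_proj_linear i).

Lemma families_inj_linear i : linear (fun v : V i => dfwith (0 : families) v : families).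
Proof.
move=> a u v; apply: familiesP => j.
rewrite -[RHS]/(a *: (dfwith (0 : families) u) j + (dfwith (0 : families) v) j).
have [<-|ij] := eqVneq i j; first by rewrite !dfwith_in.
rewrite !dfwith_out //; have -> : (0 : families) j = 0 by [].
by rewrite scaler0 addr0.
Qed.
Definition families_inj i : {linear V i -> families} :=
  mk_linear (@families_inj_linear i).

End Families.

(* Matching on the opaque [dsum_key] keeps unification from unfolding the vector
   space structure of [dsum V], which is the one of [families V]. *)
Fact dsum_key : unit. Proof. exact: tt. Qed.

Definition dsum_at (u : unit) (I : finType) (V : I -> lmodType k) : lmodType k :=
  match u with tt => families V end.

Section DirectSum.
Variables (I : finType) (V : I -> lmodType k).

Definition dsum : lmodType k := dsum_at dsum_key V.

Definition dsum_proj (i : I) : {linear dsum -> V i} :=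
  match dsum_key as u return {linear dsum_at u V -> V i} with
  | tt => families_proj V i
  end.

Definition dsum_inj (i : I) : {linear V i -> dsum} :=
  match dsum_key as u return {linear V i -> dsum_at u V} with
  | tt => families_inj V i
  end.

Lemma dsumP (x y : dsum) : (forall i, dsum_proj i x = dsum_proj i y) -> x = y.
Proof.
by move: x y; rewrite /dsum /dsum_proj; case: dsum_key; apply: familiesP.
Qed.

Lemma dsum_proj_inj i (v : V i) : dsum_proj i (dsum_inj i v) = v.
Proof.
by rewrite /dsum_proj /dsum_inj /dsum; case: dsum_key; apply: dfwith_in.
Qed.

Lemma dsum_proj_inj0 i j (v : V i) : i != j -> dsum_proj j (dsum_inj i v) = 0.
Proof.
by rewrite /dsum_proj /dsum_inj /dsum; case: dsum_key; apply: dfwith_out.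
Qed.

Lemma dsum_sum (x : dsum) : x = \sum_i dsum_inj i (dsum_proj i x).
Proof.
apply: dsumP => j; rewrite linear_sum (bigD1 j) //= dsum_proj_inj.
by rewrite big1 ?addr0 // => i ij; rewrite dsum_proj_inj0.
Qed.

End DirectSum.

Section LinSum.
Variables (I : finType) (U V : lmodType k) (f : I -> {linear U -> V}).

Lemma lin_sum_linear : linear (fun u => \sum_i f i u).
Proof.
move=> a u v; rewrite scaler_sumr -big_split /=.
by apply: eq_bigr => i _; rewrite linearP.
Qed.
Definition lin_sum : {linear U -> V} := mk_linear lin_sum_linear.

Lemma lin_sumE u : lin_sum u = \sum_i f i u.
Proof. by []. Qed.

End LinSum.

Definition dsum_lift (I : finType) (V : I -> lmodType k) (U : lmodType k)
    (f : forall i, {linear V i -> U}) : {linear dsum V -> U} :=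
  lin_sum (fun i => lin_comp (f i) (dsum_proj V i)).

Lemma dsum_liftE (I : finType) (V : I -> lmodType k) (U : lmodType k)
    (f : forall i, {linear V i -> U}) i (v : V i) :
  dsum_lift f (dsum_inj V i v) = f i v.
Proof.
rewrite lin_sumE (bigD1 i) //= dsum_proj_inj big1 ?addr0 // => j ij.
by rewrite dsum_proj_inj0 1?eq_sym // linear0.
Qed.

Lemma dsum_ind_eq (I : finType) (V : I -> lmodType k) (U : lmodType k)
    (f g : {linear dsum V -> U}) :
  (forall i v, f (dsum_inj V i v) = g (dsum_inj V i v)) -> f = g.
Proof.
move=> fg; apply: linear_funP => x; rewrite [x]dsum_sum !linear_sum.
by apply: eq_bigr => i _.
Qed.

Section TensorSpace.
Variables V W : lmodType k.

(* The free vector space on the underlying set of V * W. *)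
Local Notation free := {malg k[(V * W)%type]}.
Local Notation gen v w := (mkmalgU (v, w) (1 : k) : free).

(* The subspace spanned by the bilinearity relations. *)
Inductive tensor_rel : free -> Prop :=
| tensor_rel_addl v v' w :
    tensor_rel (gen (v + v') w - gen v w - gen v' w)
| tensor_rel_addr v w w' :
    tensor_rel (gen v (w + w') - gen v w - gen v w')
| tensor_rel_scalel a v w : tensor_rel (gen (a *: v) w - a *: gen v w)
| tensor_rel_scaler a v w : tensor_rel (gen v (a *: w) - a *: gen v w)
| tensor_rel0 : tensor_rel 0
| tensor_rel_lin a x y : tensor_rel x -> tensor_rel y -> tensor_rel (a *: x + y).

Definition tensor_relb : free -> bool := fun x => `[< tensor_rel x >].

Lemma tensor_relb_zmod : zmod_closed tensor_relb.
Proof.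
split; first by apply/asboolP; exact: tensor_rel0.
move=> x y /asboolP xr /asboolP yr; apply/asboolP.
by rewrite addrC -scaleN1r; apply: tensor_rel_lin.
Qed.
Definition tensor_rel_closed : zmodClosed free :=
  HB.pack tensor_relb
    (GRing.isZmodClosed.Build free tensor_relb tensor_relb_zmod).

Definition tensor_space : Type := Quotient.quot tensor_rel_closed.

HB.instance Definition _ := Choice.on tensor_space.
HB.instance Definition _ := GRing.Zmodule.on tensor_space.

Definition tensor_pi (x : free) : tensor_space := \pi_(Quotient.quot tensor_rel_closed) x.

Lemma tensor_piP x y : tensor_pi x = tensor_pi y <-> tensor_rel (x - y).
Proof.
rewrite /tensor_pi; split.
  by move/eqP; rewrite -Quotient.idealrBE => /asboolP.
by move=> xy; apply/eqP; rewrite -Quotient.idealrBE; apply/asboolP.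
Qed.

Lemma tensor_piD : {morph tensor_pi : x y / x + y}.
Proof. exact: Quotient.pi_add. Qed.

Lemma tensor_reprK (t : tensor_space) : tensor_pi (repr t) = t.
Proof. exact: reprK. Qed.

Definition tscale : k -> tensor_space -> tensor_space :=
  fun a t => tensor_pi (a *: repr t).

Lemma tscale_pi a x : tscale a (tensor_pi x) = tensor_pi (a *: x).
Proof.
apply/tensor_piP; rewrite -scalerBr -[_ *: _]addr0.
apply: tensor_rel_lin; last exact: tensor_rel0.
by apply/tensor_piP; rewrite tensor_reprK.
Qed.

Let tscaleA a b t : tscale a (tscale b t) = tscale (a * b) t.
Proof. by rewrite -[t]tensor_reprK !tscale_pi scalerA. Qed.
Let tscale1 : left_id 1 tscale.
Proof. by move=> t; rewrite -[t]tensor_reprK tscale_pi scale1r. Qed.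
Let tscaleDr : right_distributive tscale +%R.
Proof.
move=> a t u; rewrite -[t]tensor_reprK -[u]tensor_reprK.
by rewrite -tensor_piD !tscale_pi scalerDr tensor_piD.
Qed.
Let tscaleDl t : {morph tscale^~ t : a b / a + b}.
Proof.
by move=> a b; rewrite -[t]tensor_reprK !tscale_pi scalerDl tensor_piD.
Qed.

HB.instance Definition _ :=
  GRing.Zmodule_isLmodule.Build k tensor_space tscaleA tscale1 tscaleDr tscaleDl.

Lemma tensor_pi_linear : linear tensor_pi.
Proof. by move=> a x y; rewrite tensor_piD -tscale_pi. Qed.
HB.instance Definition _ :=
  GRing.isLinear.Build k free tensor_space *:%R tensor_pi tensor_pi_linear.

Definition tens_space (v : V) (w : W) : tensor_space := tensor_pi (gen v w).

Lemma tens_space_bilinear :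
  bilinear_for (GRing.Scale.Law.clone _ _ *:%R _)
               (GRing.Scale.Law.clone _ _ *:%R _) tens_space.
Proof.
have split3 (a b c d : free) : a - (b + c) = 1 *: (a - d - c) + (d - b).
  by rewrite scale1r addrA [_ - c + d]addrAC subrK opprD addrA addrAC.
split=> [w|v] a x y; rewrite /tens_space -linearZ -tensor_piD; apply/tensor_piP.
  rewrite (split3 _ _ _ (gen (a *: x) w)); apply: tensor_rel_lin.
    exact: tensor_rel_addl.
  exact: tensor_rel_scalel.
rewrite (split3 _ _ _ (gen v (a *: x))); apply: tensor_rel_lin.
  exact: tensor_rel_addr.
exact: tensor_rel_scaler.
Qed.
HB.instance Definition _ :=
  bilinear_isBilinear.Build k V W tensor_space *:%R *:%R tens_space tens_space_bilinear.

Section Lift.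
Variables (U : lmodType k) (f : {bilinear V -> W -> U}).

Let flift (x : free) : U := \sum_(p <- msupp x) x@_p *: f p.1 p.2.

Let fliftE (D : {fset (V * W)%type}) x : (msupp x `<=` D)%fset ->
  flift x = \sum_(p <- D) x@_p *: f p.1 p.2.
Proof.
move=> xD; rewrite /flift (big_fset_incl _ xD) // => p _ /mcoeff_outdom ->.
by rewrite scale0r.
Qed.

Let flift_linear : linear flift.
Proof.
move=> a x y; pose D := (msupp x `|` msupp y `|` msupp (a *: x + y))%fset.
have xD : (msupp x `<=` D)%fset by rewrite /D -fsetUA fsubsetUl.
have yD : (msupp y `<=` D)%fset by rewrite /D fsetUAC fsubsetUr.
rewrite (fliftE xD) (fliftE yD) (@fliftE D) ?fsubsetUr //.
rewrite scaler_sumr -big_split; apply: eq_bigr => p _ /=.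
by rewrite mcoeffD mcoeffZ scalerDl scalerA.
Qed.

Let flift_gen v w : flift (gen v w) = f v w.
Proof.
rewrite (fliftE (D := [fset (v, w)]%fset)) ?msuppU_le //.
by rewrite big_seq_fset1 mcoeffUU scale1r.
Qed.

Let fliftZ a x : flift (a *: x) = a *: flift x.
Proof. by have := flift_linear a x 0; rewrite !addr0 {3}/flift msupp0 big_nil addr0. Qed.
Let fliftD x y : flift (x + y) = flift x + flift y.
Proof. by have := flift_linear 1 x y; rewrite !scale1r. Qed.

Let fliftB x y : flift (x - y) = flift x - flift y.
Proof. by rewrite -[in LHS](scaleN1r y) fliftD fliftZ scaleN1r. Qed.

Let flift_rel x : tensor_rel x -> flift x = 0.
Proof.
elim=> [v v' w|v w w'|a v w|a v w||a {}x y _ x0 _ y0].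
- by rewrite !fliftB !flift_gen linearDl addrAC addrK subrr.
- by rewrite !fliftB !flift_gen linearDr addrAC addrK subrr.
- by rewrite fliftB fliftZ !flift_gen linearZl_LR subrr.
- by rewrite fliftB fliftZ !flift_gen linearZr_LR subrr.
- by rewrite /flift msupp0 big_nil.
- by rewrite flift_linear x0 y0 scaler0 addr0.
Qed.

Definition tensor_lift_fun (t : tensor_space) : U := flift (repr t).

Let tensor_lift_pi x : tensor_lift_fun (tensor_pi x) = flift x.
Proof.
have /tensor_piP/flift_rel : tensor_pi (repr (tensor_pi x)) = tensor_pi x.
  exact: tensor_reprK.
by rewrite fliftB => /eqP; rewrite subr_eq0 => /eqP.
Qed.

Lemma tensor_lift_linear : linear tensor_lift_fun.
Proof.
move=> a t u; rewrite -[t]tensor_reprK -[u]tensor_reprK -tensor_pi_linear.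
by rewrite !tensor_lift_pi flift_linear.
Qed.
HB.instance Definition _ :=
  GRing.isLinear.Build k tensor_space U *:%R tensor_lift_fun tensor_lift_linear.

Definition tensor_space_lift : {linear tensor_space -> U} := tensor_lift_fun.

Lemma tensor_space_liftE v w : tensor_space_lift (tens_space v w) = f v w.
Proof. by rewrite -flift_gen -tensor_lift_pi. Qed.

End Lift.

Lemma tensor_space_ind_eq (U : lmodType k) (f g : {linear tensor_space -> U}) :
  (forall v w, f (tens_space v w) = g (tens_space v w)) -> f = g.
Proof.
move=> fg; apply: linear_funP => t; rewrite -[t]tensor_reprK.
rewrite [repr t]monalgE !linear_sum; apply: eq_bigr => -[v w] _.
have -> : << (repr t)@_(v, w) *g (v, w) >> = (repr t)@_(v, w) *: gen v w :> free.
  by apply/malgP => p; rewrite mcoeffZ !mcoeffU mulrnAr mulr1.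
by rewrite !linearZ; congr (_ *: _); apply: fg.
Qed.

End TensorSpace.

(* As for [dsum], the opaque [tensor_key] hides the structure of [tensor V W],
   which is the one of [tensor_space V W]. *)
Fact tensor_key : unit. Proof. exact: tt. Qed.

Definition tensor_at (u : unit) (V W : lmodType k) : lmodType k :=
  match u with tt => tensor_space V W end.

Definition tensor (V W : lmodType k) : lmodType k := tensor_at tensor_key V W.

Definition tens (V W : lmodType k) : {bilinear V -> W -> tensor V W} :=
  match tensor_key as u return {bilinear V -> W -> tensor_at u V W} with
  | tt => @tens_space V W
  end.
Arguments tens {V W}.

Definition tensor_lift (V W U : lmodType k) (f : {bilinear V -> W -> U}) :
    {linear tensor V W -> U} :=
  match tensor_key as u return {linear tensor_at u V W -> U} with
  | tt => tensor_space_lift f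
  end.

Lemma tensor_liftE (V W U : lmodType k) (f : {bilinear V -> W -> U}) v w :
  tensor_lift f (tens v w) = f v w.
Proof.
by rewrite /tensor_lift /tens /tensor; case: tensor_key; apply: tensor_space_liftE.
Qed.

Lemma tensor_ind_eq (V W U : lmodType k) (f g : {linear tensor V W -> U}) :
  (forall v w, f (tens v w) = g (tens v w)) -> f = g.
Proof.
by move: f g; rewrite /tens /tensor; case: tensor_key; apply: tensor_space_ind_eq.
Qed.

Section TensorMap.
Variables (V W V' W' : lmodType k).
Variables (f : {linear V -> V'}) (g : {linear W -> W'}).

Definition tensor_map_bil (v : V) (w : W) : tensor V' W' := tens (f v) (g w).

Lemma tensor_map_bilinear :
  bilinear_for (GRing.Scale.Law.clone _ _ *:%R _)
               (GRing.Scale.Law.clone _ _ *:%R _) tensor_map_bil.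
Proof.
by split=> [w|v] a x y; rewrite /tensor_map_bil linearP ?linearPl ?linearPr.
Qed.
HB.instance Definition _ :=
  bilinear_isBilinear.Build k V W (tensor V' W') *:%R *:%R
    tensor_map_bil tensor_map_bilinear.

Definition tensor_map : {linear tensor V W -> tensor V' W'} :=
  tensor_lift tensor_map_bil.

Lemma tensor_mapE v w : tensor_map (tens v w) = tens (f v) (g w).
Proof. exact: tensor_liftE. Qed.

End TensorMap.

Lemma tensor_map_id (V W : lmodType k) :
  tensor_map (lin_id V) (lin_id W) = lin_id (tensor V W).
Proof. by apply: tensor_ind_eq => v w; rewrite tensor_mapE. Qed.

Lemma tensor_map_comp (V W V' W' V'' W'' : lmodType k)
    (f' : {linear V' -> V''}) (g' : {linear W' -> W''})
    (f : {linear V -> V'}) (g : {linear W -> W'}) :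
  tensor_map (lin_comp f' f) (lin_comp g' g)
  = lin_comp (tensor_map f' g') (tensor_map f g).
Proof. by apply: tensor_ind_eq => v w; rewrite /= !tensor_mapE. Qed.

Section TensorAssoc.
Variables A B C : lmodType k.

Section Inner.
Variable c : C.

Definition tensor_assoc_bil2 (a : A) (b : B) : tensor A (tensor B C) :=
  tens a (tens b c).
Lemma tensor_assoc_bilinear2 :
  bilinear_for (GRing.Scale.Law.clone _ _ *:%R _)
               (GRing.Scale.Law.clone _ _ *:%R _) tensor_assoc_bil2.
Proof. by split=> [b|a] x y z; rewrite /tensor_assoc_bil2 ?linearPl ?linearPr. Qed.
HB.instance Definition _ :=
  bilinear_isBilinear.Build k A B (tensor A (tensor B C)) *:%R *:%R
    tensor_assoc_bil2 tensor_assoc_bilinear2.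

End Inner.

Definition tensor_assoc_bil (t : tensor A B) (c : C) : tensor A (tensor B C) :=
  tensor_lift (tensor_assoc_bil2 c) t.

Lemma tensor_assoc_bilinear :
  bilinear_for (GRing.Scale.Law.clone _ _ *:%R _)
               (GRing.Scale.Law.clone _ _ *:%R _) tensor_assoc_bil.
Proof.
split=> [c|t] x y z; first by rewrite /tensor_assoc_bil linearP.
pose g := lin_add (lin_comp (GRing.scale x) (tensor_lift (tensor_assoc_bil2 y)))
                  (tensor_lift (tensor_assoc_bil2 z)).
have gE u : g u = x *: tensor_lift (tensor_assoc_bil2 y) u
                  + tensor_lift (tensor_assoc_bil2 z) u by [].
suff E : tensor_lift (tensor_assoc_bil2 (x *: y + z)) = g.
  by rewrite /tensor_assoc_bil E.
apply: tensor_ind_eq => a b; rewrite gE !tensor_liftE /=.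
by rewrite /tensor_assoc_bil2 !linearPr.
Qed.
HB.instance Definition _ :=
  bilinear_isBilinear.Build k (tensor A B) C (tensor A (tensor B C)) *:%R *:%R
    tensor_assoc_bil tensor_assoc_bilinear.

Definition tensor_assoc :
  {linear tensor (tensor A B) C -> tensor A (tensor B C)} :=
  tensor_lift tensor_assoc_bil.

Lemma tensor_assocE a b c :
  tensor_assoc (tens (tens a b) c) = tens a (tens b c).
Proof. by rewrite tensor_liftE /= /tensor_assoc_bil tensor_liftE. Qed.

End TensorAssoc.

End VectorSpaces.
Arguments tens {k V W}.

Section Species.
Variable k : fieldType.

Definition species : Type := functor FinBijCat (VectCat k).

Definition sp_val (p : species) (I : finType) : lmodType k := p I.
Definition sp_map (p : species) (I J : finType) (f : finbij I J) :
  {linear sp_val p I -> sp_val p J} := fmap p f.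

Lemma sp_map_id p I : sp_map p (finbij_id I) = lin_id (sp_val p I).
Proof. exact: (fmap1 p I). Qed.

Lemma sp_map_comp p (I J K : finType) (g : finbij J K) (f : finbij I J) :
  sp_map p (finbij_comp g f) = lin_comp (sp_map p g) (sp_map p f).
Proof. exact: (fmapM p g f). Qed.

Definition sp_hom (p q : species) : Type := nat_trans p q.
Definition sp_comp (p q : species) (s : sp_hom p q) (I : finType) :
  {linear sp_val p I -> sp_val q I} := s I.

Lemma sp_homP (p q : species) (s t : sp_hom p q) :
  (forall I x, sp_comp s I x = sp_comp t I x) -> s = t.
Proof. by move=> st; apply: nat_transP => I; apply: linear_funP => x; apply: st. Qed.

Lemma sp_naturality (p q : species) (s : sp_hom p q) (I J : finType)
    (f : finbij I J) x :
  sp_comp s J (sp_map p f x) = sp_map q f (sp_comp s I x).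
Proof. exact: (congr1 (fun g : {linear _ -> _} => g x) (naturality s f)). Qed.

Definition mk_sp_hom (p q : species)
    (c : forall I : finType, {linear sp_val p I -> sp_val q I})
    (nat : forall (I J : finType) (f : finbij I J) x,
       c J (sp_map p f x) = sp_map q f (c I x)) : sp_hom p q :=
  @NatTrans FinBijCat (VectCat k) p q c
    (fun I J f => @linear_funP k (sp_val p I) (sp_val q J)
      (lin_comp (c J) (sp_map p f)) (lin_comp (sp_map q f) (c I)) (nat I J f)).

Definition mk_species (v : finType -> lmodType k)
    (m : forall I J : finType, finbij I J -> {linear v I -> v J})
    (m1 : forall I, m I I (finbij_id I) = lin_id (v I))
    (mM : forall (I J K : finType) (g : finbij J K) (f : finbij I J),
       m I K (finbij_comp g f) = lin_comp (m J K g) (m I J f)) : species :=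
  @Functor FinBijCat (VectCat k) v m m1 mM.

Definition sp_zero_hom (p q : species) : sp_hom p q.
Proof.
apply: (@mk_sp_hom p q (fun I => lin_zero _ _)) => I J f x /=.
by rewrite linear0.
Defined.

Definition sp_opp_hom (p q : species) (s : sp_hom p q) : sp_hom p q.
Proof.
apply: (@mk_sp_hom p q (fun I => lin_opp (sp_comp s I))) => I J f x /=.
by rewrite sp_naturality linearN.
Defined.

Definition sp_add_hom (p q : species) (s t : sp_hom p q) : sp_hom p q.
Proof.
apply: (@mk_sp_hom p q (fun I => lin_add (sp_comp s I) (sp_comp t I))) => I J f x /=.
by rewrite !sp_naturality linearD.
Defined.

Definition zero_space : lmodType k := 'rV[k]_0.

Definition zero_species : species.
Proof.
by apply: (@mk_species (fun=> zero_space) (fun _ _ _ => lin_id zero_space)) => *;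
  apply: linear_funP.
Defined.

Definition biproduct_val (p q : species) (I : finType) : lmodType k :=
  (sp_val p I * sp_val q I)%type.

Definition biproduct_map_fun (p q : species) (I J : finType) (f : finbij I J)
    (x : biproduct_val p q I) : biproduct_val p q J :=
  (sp_map p f x.1, sp_map q f x.2).

Lemma biproduct_map_linear p q I J (f : finbij I J) :
  linear (@biproduct_map_fun p q I J f).
Proof. by move=> a x y; rewrite /biproduct_map_fun !linearP. Qed.

Definition biproduct_map p q I J (f : finbij I J) :
    {linear biproduct_val p q I -> biproduct_val p q J} :=
  mk_linear (@biproduct_map_linear p q I J f).

Definition biproduct_species (p q : species) : species.
Proof.
apply: (@mk_species (biproduct_val p q) (@biproduct_map p q)).
- move=> I; apply: linear_funP => -[x y].
  by rewrite /= /biproduct_map_fun !sp_map_id.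
- move=> I J K g f; apply: linear_funP => -[x y].
  by rewrite /= /biproduct_map_fun !sp_map_comp.
Defined.

Definition SpCat : additive_category.
Proof.
refine (@AdditiveCategory (functor_category FinBijCat (VectCat k))
  sp_zero_hom sp_opp_hom sp_add_hom _ _ _ _ _ _ _ _).
- by move=> p q s t u; apply: sp_homP => I x; apply: addrA.
- by move=> p q s t; apply: sp_homP => I x; apply: addrC.
- by move=> p q s; apply: sp_homP => I x; apply: add0r.
- by move=> p q s; apply: sp_homP => I x; apply: addNr.
- by move=> p q r s t u; apply: sp_homP.
- move=> p q r s t u; apply: sp_homP => I x.
  exact: (linearD (sp_comp s I)).
- exists zero_species => p; split=> s; apply: sp_homP => I x.
    exact: thinmx0.
  by rewrite (thinmx0 x) linear0.
- move=> p q.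
  pose b := biproduct_species p q.
  have lin_i1 I : linear (fun x : sp_val p I => (x, 0) : biproduct_val p q I).
    by move=> a x y; congr pair; rewrite /= scaler0 addr0.
  have lin_i2 I : linear (fun x : sp_val q I => (0, x) : biproduct_val p q I).
    by move=> a x y; congr pair; rewrite /= scaler0 addr0.
  have lin_p1 I : linear (fun x : biproduct_val p q I => x.1 : sp_val p I) by [].
  have lin_p2 I : linear (fun x : biproduct_val p q I => x.2 : sp_val q I) by [].
  pose c1 I : {linear sp_val p I -> sp_val b I} := mk_linear (@lin_i1 I).
  pose c2 I : {linear sp_val q I -> sp_val b I} := mk_linear (@lin_i2 I).
  pose d1 I : {linear sp_val b I -> sp_val p I} := mk_linear (@lin_p1 I).
  pose d2 I : {linear sp_val b I -> sp_val q I} := mk_linear (@lin_p2 I).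
  have n1 I J (f : finbij I J) x : c1 J (sp_map p f x) = sp_map b f (c1 I x).
    by congr pair; rewrite /= linear0.
  have n2 I J (f : finbij I J) x : c2 J (sp_map q f x) = sp_map b f (c2 I x).
    by congr pair; rewrite /= linear0.
  have m1 I J (f : finbij I J) x : d1 J (sp_map b f x) = sp_map p f (d1 I x).
    by [].
  have m2 I J (f : finbij I J) x : d2 J (sp_map b f x) = sp_map q f (d2 I x).
    by [].
  exists b, (mk_sp_hom n1), (mk_sp_hom n2), (mk_sp_hom m1), (mk_sp_hom m2).
  split; apply: sp_homP => I x //.
  by case: x => x y; congr pair; [apply: addr0 | apply: add0r].
Defined.

Definition one_val (b : bool) : lmodType k :=
  if b then (k^o : lmodType k) else zero_space.

Definition one_cast (b c : bool) (e : b = c) : {linear one_val b -> one_val c} :=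
  match e in _ = c return {linear one_val b -> one_val c} with
  | erefl => lin_id (one_val b)
  end.

Lemma finbij_card0 (I J : finType) (f : finbij I J) : (#|I| == 0) = (#|J| == 0).
Proof. by rewrite (bij_eq_card (finbij_bij f)). Qed.

Definition one_species : species.
Proof.
apply: (@mk_species (fun I => one_val (#|I| == 0))
          (fun I J f => one_cast (finbij_card0 f))).
- by move=> I; rewrite (Prop_irrelevance (finbij_card0 _) erefl).
- move=> I J K g f; move: (finbij_card0 (finbij_comp g f)).
  move: (finbij_card0 g) (finbij_card0 f).
  move: (#|I| == 0) (#|J| == 0) (#|K| == 0) => a b c bc ab ac; subst b c.
  by rewrite (Prop_irrelevance ac erefl); apply: linear_funP.
Defined.

Definition cover2 (I : finType) : finType :=
  {st : {set I} * {set I} | st.1 :|: st.2 == [set: I]}.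

Definition mk_cover2 (I : finType) (S T : {set I}) (e : S :|: T == [set: I]) :
  cover2 I := exist _ (S, T) e.
Definition fst_set (I : finType) (st : cover2 I) : {set I} := (proj1_sig st).1.
Definition snd_set (I : finType) (st : cover2 I) : {set I} := (proj1_sig st).2.

Lemma cover2P (I : finType) (st : cover2 I) :
  fst_set st :|: snd_set st = [set: I].
Proof. exact/eqP/(proj2_sig st). Qed.

Definition heis_summand (p q : species) (I : finType) (st : cover2 I) :
    lmodType k :=
  tensor (sp_val p (subfin (fst_set st))) (sp_val q (subfin (snd_set st))).

Definition heis_val (p q : species) (I : finType) : lmodType k :=
  dsum (@heis_summand p q I).

Lemma cover2_image_subproof (I J : finType) (f : finbij I J) (st : cover2 I) :
  f @: fst_set st :|: f @: snd_set st == [set: J].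
Proof.
rewrite -imsetU cover2P eqEsubset subsetT /=.
apply/subsetP => y _; have [g _ fK] := finbij_bij f.
by rewrite -[y]fK imset_f.
Qed.
Definition cover2_image (I J : finType) (f : finbij I J) (st : cover2 I) :
  cover2 J :=
  mk_cover2 (cover2_image_subproof f st).

Definition finbij_restr (I J : finType) (f : finbij I J) (S : {set I}) :
    finbij (subfin S) (subfin (f @: S)) :=
  restr (bij_inj (finbij_bij f)) S.

Definition heis_map (p q : species) (I J : finType) (f : finbij I J) :
    {linear heis_val p q I -> heis_val p q J} :=
  dsum_lift (fun st : cover2 I =>
    lin_comp (dsum_inj (@heis_summand p q J) (cover2_image f st))
      (tensor_map (sp_map p (finbij_restr f (fst_set st)))
                  (sp_map q (finbij_restr f (snd_set st))))).

Lemma heis_mapE (p q : species) (I J : finType) (f : finbij I J)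
    (st : cover2 I) v :
  heis_map p q f (dsum_inj (@heis_summand p q I) st v)
  = dsum_inj (@heis_summand p q J) (cover2_image f st)
      (tensor_map (sp_map p (finbij_restr f (fst_set st)))
                  (sp_map q (finbij_restr f (snd_set st))) v).
Proof. exact: dsum_liftE. Qed.

Lemma tensor_sp_map_comp (p q : species) (I1 J1 K1 I2 J2 K2 : finType)
    (g1 : finbij J1 K1) (f1 : finbij I1 J1)
    (g2 : finbij J2 K2) (f2 : finbij I2 J2) v :
  tensor_map (sp_map p g1) (sp_map q g2)
    (tensor_map (sp_map p f1) (sp_map q f2) v)
  = tensor_map (sp_map p (finbij_comp g1 f1)) (sp_map q (finbij_comp g2 f2)) v.
Proof. by rewrite !sp_map_comp tensor_map_comp. Qed.

Lemma subfin_cast_subproof (I : finType) (S S' : {set I}) (e : S = S') :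
  bijective (fun x : subfin S =>
    exist _ (subval x) (eq_ind S (fun A => subval x \in A) (proj2_sig x) S' e) : subfin S').
Proof. by subst S'; exists id => -[x xS]; apply: val_inj. Qed.
Definition subfin_cast (I : finType) (S S' : {set I}) (e : S = S') :
  finbij (subfin S) (subfin S') := FinBij (subfin_cast_subproof e).

Lemma heis_inj_cast (p q : species) (I : finType) (st st' : cover2 I)
    (e1 : fst_set st = (fst_set st')) (e2 : snd_set st = (snd_set st')) v :
  dsum_inj (@heis_summand p q I) st'
    (tensor_map (sp_map p (subfin_cast e1)) (sp_map q (subfin_cast e2)) v)
  = dsum_inj (@heis_summand p q I) st v.
Proof.
case: st st' e1 e2 v => [[S T] H] [[S' T'] H'] e1 e2 v.
change (S = S') in e1; change (T = T') in e2; subst S' T'.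
rewrite (Prop_irrelevance H' H).
have cid A (e : A = A) : @subfin_cast I A A e = finbij_id (subfin A).
  by apply: finbijP => x; apply: val_inj.
by rewrite !cid !sp_map_id tensor_map_id.
Qed.

Lemma heis_map_id p q I : heis_map p q (finbij_id I) = lin_id (heis_val p q I).
Proof.
apply: dsum_ind_eq => st v; rewrite heis_mapE.
have e1 : fst_set st = (fst_set (cover2_image (finbij_id I) st)).
  exact/esym/imset_id.
have e2 : snd_set st = (snd_set (cover2_image (finbij_id I) st)).
  exact/esym/imset_id.
have r1 : finbij_restr (finbij_id I) (fst_set st) = subfin_cast e1.
  by apply: finbijP => x; apply: val_inj.
have r2 : finbij_restr (finbij_id I) (snd_set st) = subfin_cast e2.
  by apply: finbijP => x; apply: val_inj.
by rewrite r1 r2; apply: heis_inj_cast.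
Qed.

Lemma heis_map_comp p q (I J K : finType) (g : finbij J K) (f : finbij I J) :
  heis_map p q (finbij_comp g f) = lin_comp (heis_map p q g) (heis_map p q f).
Proof.
apply: dsum_ind_eq => st v; rewrite lin_compE !heis_mapE.
have e1 : (fst_set (cover2_image (finbij_comp g f) st))
        = (fst_set (cover2_image g (cover2_image f st))).
  exact: imset_comp.
have e2 : (snd_set (cover2_image (finbij_comp g f) st))
        = (snd_set (cover2_image g (cover2_image f st))).
  exact: imset_comp.
rewrite -(heis_inj_cast e1 e2) !tensor_sp_map_comp.
have r1 : finbij_comp (subfin_cast e1) (finbij_restr (finbij_comp g f) (fst_set st))
        = finbij_comp (finbij_restr g (f @: fst_set st)) (finbij_restr f (fst_set st)).
  by apply: finbijP => x; apply: val_inj.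
have r2 : finbij_comp (subfin_cast e2) (finbij_restr (finbij_comp g f) (snd_set st))
        = finbij_comp (finbij_restr g (f @: snd_set st)) (finbij_restr f (snd_set st)).
  by apply: finbijP => x; apply: val_inj.
by rewrite r1 r2.
Qed.

Definition heisenberg_obj (p q : species) : species :=
  mk_species (@heis_map_id p q) (@heis_map_comp p q).

Definition heis_hom_comp (p q p' q' : species) (s : sp_hom p p')
    (t : sp_hom q q') (I : finType) :
    {linear heis_val p q I -> heis_val p' q' I} :=
  dsum_lift (fun st : cover2 I =>
    lin_comp (dsum_inj (@heis_summand p' q' I) st)
      (tensor_map (sp_comp s (subfin (fst_set st)))
                  (sp_comp t (subfin (snd_set st))))).

Lemma heis_hom_compE (p q p' q' : species) (s : sp_hom p p')
    (t : sp_hom q q') (I : finType) (st : cover2 I) v :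
  heis_hom_comp s t I (dsum_inj (@heis_summand p q I) st v)
  = dsum_inj (@heis_summand p' q' I) st
      (tensor_map (sp_comp s (subfin (fst_set st)))
                  (sp_comp t (subfin (snd_set st))) v).
Proof. exact: dsum_liftE. Qed.

Lemma heis_hom_natural (p q p' q' : species) (s : sp_hom p p')
    (t : sp_hom q q') (I J : finType) (f : finbij I J) x :
  heis_hom_comp s t J (heis_map p q f x) = heis_map p' q' f (heis_hom_comp s t I x).
Proof.
rewrite -!lin_compE; congr (GRing.Linear.sort _ x).
apply: dsum_ind_eq => st v.
rewrite !lin_compE heis_mapE !heis_hom_compE heis_mapE.
congr (GRing.Linear.sort _ _); rewrite -[LHS]lin_compE -[RHS]lin_compE.
rewrite -!tensor_map_comp.
have n1 : lin_comp (sp_comp s _) (sp_map p (finbij_restr f (fst_set st)))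
        = lin_comp (sp_map p' (finbij_restr f (fst_set st))) (sp_comp s _).
  by apply: linear_funP => y; rewrite !lin_compE sp_naturality.
have n2 : lin_comp (sp_comp t _) (sp_map q (finbij_restr f (snd_set st)))
        = lin_comp (sp_map q' (finbij_restr f (snd_set st))) (sp_comp t _).
  by apply: linear_funP => y; rewrite !lin_compE sp_naturality.
by rewrite n1 n2.
Qed.

Definition heisenberg_hom (p q p' q' : species) (s : sp_hom p p')
    (t : sp_hom q q') :
    sp_hom (heisenberg_obj p q) (heisenberg_obj p' q') :=
  @mk_sp_hom (heisenberg_obj p q) (heisenberg_obj p' q')
    (heis_hom_comp s t) (@heis_hom_natural p q p' q' s t).

Lemma heisenberg_hom_id (p q : species) :
  heisenberg_hom (nat_id p) (nat_id q) = nat_id (heisenberg_obj p q).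
Proof.
apply: nat_transP => I; apply: dsum_ind_eq => st v.
by rewrite [LHS]heis_hom_compE tensor_map_id.
Qed.

Lemma heisenberg_hom_comp (p q p' q' p'' q'' : species)
    (s' : sp_hom p' p'') (t' : sp_hom q' q'')
    (s : sp_hom p p') (t : sp_hom q q') :
  heisenberg_hom (nat_comp s' s) (nat_comp t' t)
  = nat_comp (heisenberg_hom s' t') (heisenberg_hom s t).
Proof.
apply: nat_transP => I; apply: dsum_ind_eq => st v.
rewrite [LHS]heis_hom_compE [RHS]lin_compE.
rewrite [X in _ = _ X]heis_hom_compE [RHS]heis_hom_compE.
by congr (GRing.Linear.sort _ _); rewrite -[RHS]lin_compE -tensor_map_comp.
Qed.

Definition heisenberg : functor (product_category SpCat SpCat) SpCat :=
  @Functor (product_category SpCat SpCat) SpCat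
    (fun pq => heisenberg_obj pq.1 pq.2)
    (fun pq pq' st => heisenberg_hom st.1 st.2)
    (fun pq => heisenberg_hom_id pq.1 pq.2)
    (fun _ _ _ st' st => heisenberg_hom_comp st'.1 st'.2 st.1 st.2).

Definition cover3 (I : finType) : finType :=
  {uvw : {set I} * {set I} * {set I}
    | uvw.1.1 :|: uvw.1.2 :|: uvw.2 == [set: I]}.

Definition set3_1 (I : finType) (uvw : cover3 I) : {set I} :=
  (proj1_sig uvw).1.1.
Definition set3_2 (I : finType) (uvw : cover3 I) : {set I} :=
  (proj1_sig uvw).1.2.
Definition set3_3 (I : finType) (uvw : cover3 I) : {set I} :=
  (proj1_sig uvw).2.

Definition heis3_summand (p q r : species) (I : finType) (uvw : cover3 I) :
    lmodType k :=
  tensor (sp_val p (subfin (set3_1 uvw)))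
    (tensor (sp_val q (subfin (set3_2 uvw))) (sp_val r (subfin (set3_3 uvw)))).

Definition heis3_val (p q r : species) (I : finType) : lmodType k :=
  dsum (@heis3_summand p q r I).

Definition heis3_inj (p q r : species) (I : finType) (U V W : {set I})
    (H : U :|: V :|: W == [set: I]) :
    {linear tensor (sp_val p (subfin U))
              (tensor (sp_val q (subfin V)) (sp_val r (subfin W)))
            -> heis3_val p q r I} :=
  dsum_inj (@heis3_summand p q r I) (exist _ (U, V, W) H).

(* [subimage U] is a subset U of a subset S of I, seen as a subset of I. *)
Definition subimage (I : finType) (S : {set I}) (U : {set subfin S}) : {set I} :=
  @subval I S @: U.

Definition subimage_bij (I : finType) (S : {set I}) (U : {set subfin S}) :
  finbij (subfin U) (subfin (subimage U)) := restr (@subval_inj I S) U.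

Lemma subimage_cover (I : finType) (S : {set I}) (uv : cover2 (subfin S)) :
  subimage (fst_set uv) :|: subimage (snd_set uv) = S.
Proof.
rewrite -imsetU cover2P; apply/setP => x; apply/imsetP/idP.
  by case=> y _ ->; apply: valP.
by move=> xS; exists (exist _ x xS).
Qed.

Lemma cover3_left (I : finType) (sw : cover2 I)
    (uv : cover2 (subfin (fst_set sw))) :
  subimage (fst_set uv) :|: subimage (snd_set uv) :|: snd_set sw == [set: I].
Proof. by rewrite subimage_cover cover2P. Qed.

Lemma cover3_right (I : finType) (ut : cover2 I)
    (vw : cover2 (subfin (snd_set ut))) :
  fst_set ut :|: subimage (fst_set vw) :|: subimage (snd_set vw) == [set: I].
Proof. by rewrite -setUA subimage_cover cover2P. Qed.

Section Identifications.
Variables (p q r : species) (I : finType).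

Section Left.
Variables (sw : cover2 I) (uv : cover2 (subfin (fst_set sw))).
Let A := sp_val p (subfin (fst_set uv)).
Let B := sp_val q (subfin (snd_set uv)).
Let C := sp_val r (subfin (snd_set sw)).
Let A' := sp_val p (subfin (subimage (fst_set uv))).
Let B' := sp_val q (subfin (subimage (snd_set uv))).

Let project :
    {linear tensor (heis_val p q (subfin (fst_set sw))) C
            -> tensor (tensor A B) C} :=
  @tensor_map k (heis_val p q (subfin (fst_set sw))) C (tensor A B) C
    (dsum_proj (@heis_summand p q (subfin (fst_set sw))) uv) (lin_id C).

Let transport : {linear tensor A (tensor B C) -> tensor A' (tensor B' C)} :=
  @tensor_map k A (tensor B C) A' (tensor B' C)
    (sp_map p (subimage_bij (fst_set uv)))
    (@tensor_map k B C B' C (sp_map q (subimage_bij (snd_set uv))) (lin_id C)).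

Definition left_component :
    {linear tensor (heis_val p q (subfin (fst_set sw)))
                   (sp_val r (subfin (snd_set sw))) -> heis3_val p q r I} :=
  @lin_comp k _ (tensor A' (tensor B' C)) _ (heis3_inj p q r (cover3_left uv))
    (@lin_comp k _ (tensor A (tensor B C)) _ transport
      (@lin_comp k _ (tensor (tensor A B) C) _ (tensor_assoc A B C) project)).

End Left.

(* Sends (a ⊗ b) ⊗ c in the summand (S, W), with a ⊗ b in the summand (U, V) of
   (p # q)[S], to a ⊗ (b ⊗ c) in the summand (U, V, W). *)
Definition left_ident :
    {linear heis_val (heisenberg_obj p q) r I -> heis3_val p q r I} :=
  @dsum_lift k (cover2 I) (@heis_summand (heisenberg_obj p q) r I)
    (heis3_val p q r I) (fun sw => lin_sum (@left_component sw)).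

Section Right.
Variables (ut : cover2 I) (vw : cover2 (subfin (snd_set ut))).
Let A := sp_val p (subfin (fst_set ut)).
Let B := sp_val q (subfin (fst_set vw)).
Let C := sp_val r (subfin (snd_set vw)).
Let B' := sp_val q (subfin (subimage (fst_set vw))).
Let C' := sp_val r (subfin (subimage (snd_set vw))).

Let project :
    {linear tensor A (heis_val q r (subfin (snd_set ut)))
            -> tensor A (tensor B C)} :=
  @tensor_map k A (heis_val q r (subfin (snd_set ut))) A (tensor B C)
    (lin_id A) (dsum_proj (@heis_summand q r (subfin (snd_set ut))) vw).

Let transport : {linear tensor A (tensor B C) -> tensor A (tensor B' C')} :=
  @tensor_map k A (tensor B C) A (tensor B' C') (lin_id A)
    (@tensor_map k B C B' C' (sp_map q (subimage_bij (fst_set vw)))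
                             (sp_map r (subimage_bij (snd_set vw)))).

Definition right_component :
    {linear tensor (sp_val p (subfin (fst_set ut)))
                   (heis_val q r (subfin (snd_set ut))) -> heis3_val p q r I} :=
  @lin_comp k _ (tensor A (tensor B' C')) _ (heis3_inj p q r (cover3_right vw))
    (@lin_comp k _ (tensor A (tensor B C)) _ transport project).

End Right.

(* Sends a ⊗ (b ⊗ c) in the summand (U, T), with b ⊗ c in the summand (V, W) of
   (q # r)[T], to a ⊗ (b ⊗ c) in the summand (U, V, W). *)
Definition right_ident :
    {linear heis_val p (heisenberg_obj q r) I -> heis3_val p q r I} :=
  @dsum_lift k (cover2 I) (@heis_summand p (heisenberg_obj q r) I)
    (heis3_val p q r I) (fun ut => lin_sum (@right_component ut)).

End Identifications.

Definition natural_associativity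
    (a : forall p q r : species,
       sp_hom (heisenberg_obj (heisenberg_obj p q) r)
              (heisenberg_obj p (heisenberg_obj q r))) : Prop :=
  forall (p q r : species) (I : finType),
    [/\ bijective (left_ident p q r I),
        bijective (right_ident p q r I)
      & forall x, right_ident p q r I (sp_comp (a p q r) I x)
                  = left_ident p q r I x].

End Species.

(* Main.v *)
(* Call A -> I <- B a cover of I if the two maps are injective and jointly
   surjective. A vector a ⊗ b of p[A] ⊗ q[B] has a well-defined image in
   (p # q)[I], namely in the summand indexed by the two images; these vectors
   span, and they depend on the cover only up to relabelling of A and B.
   Iterated products are spanned by iterated vectors, and a cover
   S -> I <- C refined by A -> S <- B yields the triple A, B, C -> I, through
   which both bracketings are compared with the sum over triples. Hence the
   associator sends (a ⊗ b) ⊗ c to a ⊗ (b ⊗ c) for *any* T -> I through which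
   B -> I and C -> I factor. This freedom in the choice of T reduces naturality,
   the pentagon and the triangle to factoring embeddings. The vectors of 1[A]
   vanish unless A is empty, in which case B -> I is a bijection; this gives the
   left unitor, and the symmetry of # gives the right one. *)
From HB Require Import structures.
Require Import Defs.
From mathcomp Require Import all_boot ssralg.
From mathcomp Require Import sesquilinear boolp.
Set Implicit Arguments.
Unset Strict Implicit.
Unset Printing Implicit Defensive.
Import GRing.Theory.
Local Open Scope ring_scope.

Lemma is_iso_comp (C : category) (x y z : C) (g : hom y z) (f : hom x y) :
  is_iso g -> is_iso f -> is_iso (g ∘ f)%cat.
Proof.
move=> [g' [g'g gg']] [f' [f'f ff']]; exists (f' ∘ g')%cat; split.
  by rewrite compcA -(compcA f') g'g compc1.
by rewrite compcA -(compcA g) ff' compc1.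
Qed.

(** * Embeddings of finite sets *)

Record emb (A I : finType) := Emb {
  emb_fun :> A -> I;
  emb_inj : injective emb_fun
}.

Lemma embP (A I : finType) (f g : emb A I) : f =1 g -> f = g.
Proof.
case: f g => [f fi] [g gi] /= /funext fg; subst g.
by congr Emb; apply: Prop_irrelevance.
Qed.

Definition emb_id (I : finType) : emb I I := Emb (@inj_id I).

Definition emb_comp (A B I : finType) (g : emb B I) (f : emb A B) : emb A I :=
  Emb (inj_comp (@emb_inj _ _ g) (@emb_inj _ _ f)).

Definition emb_bij (A I : finType) (f : finbij A I) : emb A I :=
  Emb (bij_inj (finbij_bij f)).

Definition emb_sub (I : finType) (S : {set I}) : emb (subfin S) I :=
  Emb (@subval_inj I S).

Definition emb_void (I : finType) : emb void I :=
  Emb (emb_fun := @of_void I) (fun x : void => match x with end).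

Lemma emb_compA (A B C I : finType) (h : emb C I) (g : emb B C) (f : emb A B) :
  emb_comp h (emb_comp g f) = emb_comp (emb_comp h g) f.
Proof. exact: embP. Qed.

Lemma emb_comp_inj (A B I : finType) (k : emb B I) (f g : emb A B) :
  emb_comp k f = emb_comp k g -> f = g.
Proof.
move=> kfg; apply: embP => x; apply: (@emb_inj _ _ k).
exact: (congr1 (fun h : emb A I => h x) kfg).
Qed.

Definition range (A I : finType) (f : emb A I) : {set I} := f @: [set: A].

Lemma rangeP (A I : finType) (f : emb A I) x :
  reflect (exists a, x = f a) (x \in range f).
Proof.
by apply: (iffP imsetP) => [[a _ ->]|[a ->]]; exists a.
Qed.

Lemma mem_range (A I : finType) (f : emb A I) a : f a \in range f.
Proof. exact: imset_f. Qed.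

Lemma range_sub (I : finType) (S : {set I}) : range (emb_sub S) = S.
Proof.
apply/setP => x; apply/rangeP/idP => [[y ->]|xS]; first exact: valP.
by exists (exist _ x xS).
Qed.

Lemma range_bij (A B I : finType) (f : emb B I) (s : finbij A B) :
  range (emb_comp f (emb_bij s)) = range f.
Proof.
apply/setP => x; apply/rangeP/rangeP => [] [a ->] /=; first by exists (s a).
by have [t _ tK] := finbij_bij s; exists (t a); rewrite /= tK.
Qed.

Lemma range_onto (A I : finType) (f : emb A I) (S : {set I}) (u : finbij A (subfin S)) :
  (forall x, subval (u x) = f x) -> range f = S.
Proof.
move=> uf; rewrite -[RHS]range_sub -(range_bij _ u); congr range.
by apply: embP => x; rewrite -uf.
Qed.

(** Each [f a] has a preimage under [k]. A choice of preimages is injective because its composite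
    with [k] is [f]. *)
Lemma range_factor (A B I : finType) (f : emb A I) (k : emb B I) :
  range f \subset range k -> exists l : emb A B, f = emb_comp k l.
Proof.
move=> /subsetP fk.
have fkP a : exists b, f a = k b by apply/rangeP/fk/mem_range.
pose l a := projT1 (cid (fkP a)); have lE a : f a = k (l a) := projT2 (cid (fkP a)).
have l_inj : injective l by move=> a a' aa; apply: (@emb_inj _ _ f); rewrite !lE aa.
by exists (Emb l_inj); apply: embP => a; rewrite lE.
Qed.

(* Onto a set [S] only propositionally equal to the range, so that no cast is
   needed when [S] is produced by another construction. *)
Definition corange_fun (A I : finType) (f : emb A I) (S : {set I})
    (fS : range f = S) (a : A) : subfin S :=
  exist _ (f a) (eq_ind _ (fun T : {set I} => f a \in T) (mem_range f a) S fS).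

Lemma corange_bij (A I : finType) (f : emb A I) (S : {set I}) (fS : range f = S) :
  bijective (corange_fun fS).
Proof.
apply: inj_card_bij => [x y /(congr1 val) /= /emb_inj //|].
by rewrite card_sig (eq_card (B := S)) // -fS card_imset ?cardsT //; apply: emb_inj.
Qed.

Definition corange (A I : finType) (f : emb A I) (S : {set I}) (fS : range f = S) :
  finbij A (subfin S) := FinBij (corange_bij fS).

(** * Covers by two and by three embeddings *)

Definition covers (A B I : finType) (f : emb A I) (g : emb B I) : bool :=
  range f :|: range g == [set: I].

Lemma coversP (A B I : finType) (f : emb A I) (g : emb B I) :
  reflect (forall x, (exists a, x = f a) \/ (exists b, x = g b)) (covers f g).
Proof.
apply: (iffP eqP) => [fg x|fg].
  by have := in_setT x; rewrite -fg => /setUP [/rangeP|/rangeP]; [left|right].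
by apply/setP => x; rewrite !inE; have [/rangeP->|/rangeP->] := fg x; rewrite ?orbT.
Qed.

Lemma covers_range (A B S I : finType) (f : emb S I) (g : emb A S) (h : emb B S) :
  covers g h -> range f = range (emb_comp f g) :|: range (emb_comp f h).
Proof.
move=> /coversP gh; apply/setP => x; rewrite inE; apply/rangeP/orP.
  case=> s ->; have [[a ->]|[b ->]] := gh s; [left|right]; apply/rangeP.
    by exists a.
  by exists b.
by case=> /rangeP [a ->]; [exists (g a)|exists (h a)].
Qed.

Lemma coversC (A B I : finType) (f : emb A I) (g : emb B I) :
  covers f g -> covers g f.
Proof. by rewrite /covers setUC. Qed.

Lemma covers_void (I : finType) : covers (emb_void I) (emb_id I).
Proof. by apply/coversP => x; right; exists x. Qed.

(** An empty [A] contributes no point, so [g] alone is onto. Applied to the unit species, this turns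
    the other embedding of a cover into a relabelling. *)
Lemma covers_card0 (A B I : finType) (f : emb A I) (g : emb B I) :
  covers f g -> #|A| = 0 -> exists s : finbij B I, g = emb_bij s.
Proof.
move=> /coversP fg A0.
have gP x : exists b, x = g b by have [[a _]|//] := fg x; have := card0_eq A0 a.
have gB : bijective g.
  apply: (inj_card_bij (@emb_inj _ _ g)); rewrite -(card_imset _ (@emb_inj _ _ g)).
  by apply/subset_leq_card/subsetP => x _; have [b ->] := gP x; apply: imset_f.
by exists (FinBij gB); apply: embP.
Qed.

Lemma card0_void (A : finType) : #|A| = 0 -> exists s : finbij A void, True.
Proof.
move=> A0; have nA (a : A) : False by have := card0_eq A0 a.
pose f (a : A) : void := match nA a with end.
have fB : bijective f by exists (of_void A) => a; [case: (nA a)|case: a].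
by exists (FinBij fB).
Qed.

Lemma covers_emb (A B I J : finType) (h : finbij I J) (f : emb A I) (g : emb B I) :
  covers f g -> covers (emb_comp (emb_bij h) f) (emb_comp (emb_bij h) g).
Proof.
move=> /coversP fg; apply/coversP => y; have [t _ tK] := finbij_bij h.
have [[a ta]|[b tb]] := fg (t y); [left; exists a|right; exists b].
  by rewrite /= -ta tK.
by rewrite /= -tb tK.
Qed.

Lemma covers_sub (I : finType) (S T : {set I}) :
  S :|: T == [set: I] -> covers (emb_sub S) (emb_sub T).
Proof. by rewrite /covers !range_sub. Qed.

Definition covers3 (A B C I : finType) (f : emb A I) (g : emb B I) (h : emb C I) :
  bool := range f :|: range g :|: range h == [set: I].

Lemma covers3_left (A B C S I : finType) (f : emb S I) (h : emb C I)
    (f' : emb A S) (g' : emb B S) :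
  covers f h -> covers f' g' -> covers3 (emb_comp f f') (emb_comp f g') h.
Proof. by move=> fh fg'; rewrite /covers3 -covers_range. Qed.

Lemma covers3_right (A B C T I : finType) (f : emb A I) (h : emb T I)
    (g' : emb B T) (h' : emb C T) :
  covers f h -> covers g' h' -> covers3 f (emb_comp h g') (emb_comp h h').
Proof. by move=> fh gh'; rewrite /covers3 -setUA -covers_range. Qed.

(** [T] is the union of the two ranges inside [I]. It supplies the middle set that the associator
    needs for the right-hand bracketing. *)
Lemma factor_cover (B C I : finType) (g : emb B I) (h : emb C I) :
  exists (T : finType) (k : emb T I) (g' : emb B T) (h' : emb C T),
    [/\ g = emb_comp k g', h = emb_comp k h' & covers g' h'].
Proof.
pose S := range g :|: range h; pose k := emb_sub S.
have [|g' gE] := @range_factor _ _ _ g k; first by rewrite range_sub subsetUl.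
have [|h' hE] := @range_factor _ _ _ h k; first by rewrite range_sub subsetUr.
exists (subfin S), k, g', h'; split=> //; apply/coversP => x.
have /setUP [/rangeP [b xb]|/rangeP [c xc]] : k x \in S by apply: valP.
  by left; exists b; apply: (@emb_inj _ _ k); rewrite xb gE.
by right; exists c; apply: (@emb_inj _ _ k); rewrite xc hE.
Qed.

(** The range of [k] is the union of those of B and C in [I]. Adding that of A recovers the ranges
    of [f] and [h], which exhaust [I]. *)
Lemma covers_assocr (A B C S T I : finType) (f : emb S I) (h : emb C I)
    (f' : emb A S) (g' : emb B S) (k : emb T I) (g : emb B T) (h' : emb C T) :
  covers f h -> covers f' g' -> covers g h' ->
  emb_comp f g' = emb_comp k g -> h = emb_comp k h' -> covers (emb_comp f f') k.
Proof.
move=> fh fg' gh' fk hk; rewrite /covers (covers_range k gh') -fk -hk setUA.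
by rewrite -covers_range.
Qed.

(** Since [g] and [h] cover T', the range of [F] is made of points that already lie in the range of
    [k]. The two triangles then commute because [k] can be cancelled. In the pentagon this compares
    two middle sets. *)
Lemma covers_lift (B C T T' I : finType) (F : emb T' I) (k : emb T I)
    (g : emb B T') (h : emb C T') (g' : emb B T) (h' : emb C T) :
  covers g h -> emb_comp F g = emb_comp k g' -> emb_comp F h = emb_comp k h' ->
  exists l : emb T' T, [/\ F = emb_comp k l, emb_comp l g = g' & emb_comp l h = h'].
Proof.
move=> gh Fg Fh; have [|l lE] := @range_factor _ _ _ F k.
  rewrite (covers_range F gh) Fg Fh subUset.
  by apply/andP; split; apply/subsetP => _ /rangeP [a ->]; apply: mem_range.
by exists l; split=> //; apply: (@emb_comp_inj _ _ _ k); rewrite emb_compA -lE.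
Qed.

Definition emb_subset (I : finType) (S T : {set I}) (ST : S \subset T) :
  emb (subfin S) (subfin T).
Proof.
apply: (@Emb _ _ (fun x : subfin S =>
  exist _ (subval x) (subsetP ST _ (proj2_sig x)) : subfin T)).
by move=> x y /(congr1 val) /= /val_inj.
Defined.

Lemma emb_subsetK (I : finType) (S T : {set I}) (ST : S \subset T) :
  emb_comp (emb_sub T) (emb_subset ST) = emb_sub S.
Proof. exact: embP. Qed.

Lemma covers_subsetU (I : finType) (S T : {set I}) :
  covers (emb_subset (subsetUl S T)) (emb_subset (subsetUr S T)).
Proof.
apply/coversP => -[x xST]; have /setUP [xS|xT] := xST.
  by left; exists (exist _ x xS); apply: val_inj.
by right; exists (exist _ x xT); apply: val_inj.
Qed.

Lemma covers3_sub (I : finType) (uvw : cover3 I) :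
  covers3 (emb_sub (set3_1 uvw)) (emb_sub (set3_2 uvw)) (emb_sub (set3_3 uvw)).
Proof. by rewrite /covers3 !range_sub; case: uvw. Qed.

Lemma covers_left_sub (I : finType) (uvw : cover3 I) :
  covers (emb_sub (set3_1 uvw :|: set3_2 uvw)) (emb_sub (set3_3 uvw)).
Proof. by rewrite /covers !range_sub; case: uvw. Qed.

Lemma covers_right_sub (I : finType) (uvw : cover3 I) :
  covers (emb_sub (set3_1 uvw)) (emb_sub (set3_2 uvw :|: set3_3 uvw)).
Proof. by rewrite /covers !range_sub setUA; case: uvw. Qed.

(** * Tensor products of vector spaces *)

Section TensorSwap.
Variables (k : fieldType) (V W : lmodType k).

Definition tensor_swap_bil (v : V) (w : W) : tensor W V := tens w v.
Lemma tensor_swap_bilinear :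
  bilinear_for (GRing.Scale.Law.clone _ _ *:%R _)
               (GRing.Scale.Law.clone _ _ *:%R _) tensor_swap_bil.
Proof. by split=> [w|v] a x y; rewrite /tensor_swap_bil ?linearPl ?linearPr. Qed.
HB.instance Definition _ :=
  bilinear_isBilinear.Build k V W (tensor W V) *:%R *:%R
    tensor_swap_bil tensor_swap_bilinear.

Definition tensor_swap : {linear tensor V W -> tensor W V} :=
  tensor_lift tensor_swap_bil.

Lemma tensor_swapE v w : tensor_swap (tens v w) = tens w v.
Proof. exact: tensor_liftE. Qed.

End TensorSwap.

(** The inverse associativity is obtained from [tensor_assoc] by swaps: a(bc), (bc)a, (cb)a, c(ba),
    (ba)c, (ab)c. *)
Definition tensor_unassoc (k : fieldType) (A B C : lmodType k) :
    {linear tensor A (tensor B C) -> tensor (tensor A B) C} :=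
  lin_comp (tensor_map (tensor_swap B A) (lin_id C))
    (lin_comp (tensor_swap C (tensor B A))
      (lin_comp (tensor_assoc C B A)
        (lin_comp (tensor_map (tensor_swap B C) (lin_id A))
          (tensor_swap A (tensor B C))))).

Lemma tensor_unassocE (k : fieldType) (A B C : lmodType k) a b c :
  tensor_unassoc A B C (tens a (tens b c)) = tens (tens a b) c.
Proof.
by rewrite !lin_compE !(tensor_swapE, tensor_mapE, tensor_assocE).
Qed.

Lemma tens_linearr (k : fieldType) (V W : lmodType k) (v : V) : linear (@tens k V W v).
Proof. by move=> a x y; rewrite linearPr. Qed.

(** Extensionality is used twice: on the outer product, and then, with [a] fixed, along the linear
    map t ↦ a ⊗ t. *)
Lemma tensor3_ext (k : fieldType) (A B C U : lmodType k)
    (F G : {linear tensor A (tensor B C) -> U}) :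
  (forall a b c, F (tens a (tens b c)) = G (tens a (tens b c))) -> F = G.
Proof.
move=> FG; apply: tensor_ind_eq => a t.
pose ta := mk_linear (@tens_linearr _ _ (tensor B C) a).
suff E : lin_comp F ta = lin_comp G ta.
  exact: (congr1 (fun f : {linear _ -> _} => f t) E).
by apply: tensor_ind_eq => b c; apply: FG.
Qed.

Section TensorScale.
Variables (k : fieldType) (V W U : lmodType k).
Variables (e : {linear V -> k^o}) (l : {linear W -> U}).

Definition tensor_scale_bil (v : V) (w : W) : U := e v *: l w.
Lemma tensor_scale_bilinear :
  bilinear_for (GRing.Scale.Law.clone _ _ *:%R _)
               (GRing.Scale.Law.clone _ _ *:%R _) tensor_scale_bil.
Proof.
split=> [w|v] a x y; rewrite /= /tensor_scale_bil linearP.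
  by rewrite scalerDl -[in LHS]scalerA.
by rewrite scalerDr !scalerA mulrC.
Qed.
HB.instance Definition _ :=
  bilinear_isBilinear.Build k V W U *:%R *:%R tensor_scale_bil tensor_scale_bilinear.

(** This is e ⊗ l followed by the canonical isomorphism of k ⊗ U with U, the shape of each component
    of the left unitor. *)
Definition tensor_scale : {linear tensor V W -> U} := tensor_lift tensor_scale_bil.

Lemma tensor_scaleE v w : tensor_scale (tens v w) = e v *: l w.
Proof. exact: tensor_liftE. Qed.

End TensorScale.

(** * Spanning vectors of Heisenberg products *)

Section Generators.
Variable k : fieldType.
Implicit Types p q r s : species k.

Lemma sp_map_compE p (I J K : finType) (g : finbij J K) (f : finbij I J) x :
  sp_map p g (sp_map p f x) = sp_map p (finbij_comp g f) x.
Proof. by rewrite sp_map_comp. Qed.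

Section HTens.
Variables (p q : species k) (A B I : finType) (f : emb A I) (g : emb B I).
Hypothesis fg : covers f g.

Definition htens_lin : {linear tensor (sp_val p A) (sp_val q B) -> heis_val p q I} :=
  lin_comp (dsum_inj (@heis_summand k p q I) (mk_cover2 fg))
    (tensor_map (sp_map p (corange (erefl (range f))))
                (sp_map q (corange (erefl (range g))))).

(* The vector a ⊗ b of the summand (range f, range g). Indexing by embeddings
   rather than by subsets of I avoids casts between equal subsets. *)
Definition htens a b : heis_val p q I := htens_lin (tens a b).

Lemma htens_linearl b : linear (htens^~ b).
Proof. by move=> a x y; rewrite /htens linearPl linearP. Qed.
Lemma htens_linearr a : linear (htens a).
Proof. by move=> c x y; rewrite /htens linearPr linearP. Qed.
(** Fixing one factor gives honest linear maps, so that equalities on iterated products can be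
    tested one factor at a time. *)
Definition htensl b : {linear sp_val p A -> heis_val p q I} :=
  mk_linear (htens_linearl b).
Definition htensr a : {linear sp_val q B -> heis_val p q I} :=
  mk_linear (htens_linearr a).

End HTens.

(** Once the index sets are replaced by the ranges of [f] and [g], injectivity of [subval] forces
    [u] and [v] to be the coranges. Leaving [st], [u] and [v] arbitrary lets any composite of
    relabellings be normalised without casts. *)
Lemma htensE p q (A B I : finType) (f : emb A I) (g : emb B I) (fg : covers f g)
    (st : cover2 I) (u : finbij A (subfin (fst_set st)))
    (v : finbij B (subfin (snd_set st))) a b :
  (forall x, subval (u x) = f x) -> (forall x, subval (v x) = g x) ->
  dsum_inj (@heis_summand k p q I) st (tens (sp_map p u a) (sp_map q v b))
  = htens fg a b.
Proof.
case: st u v => [[S T] e] /= u v uf vg.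
have fS : range f = S := range_onto uf.
have gT : range g = T := range_onto vg.
subst S T; rewrite (eq_irrelevance e fg).
have -> : u = corange (erefl (range f)) by apply: finbijP => x; apply: val_inj; apply: uf.
have -> : v = corange (erefl (range g)) by apply: finbijP => x; apply: val_inj; apply: vg.
by rewrite /htens lin_compE tensor_mapE.
Qed.

Lemma htens_eq p q (A B I : finType) (f f' : emb A I) (g g' : emb B I)
    (fg : covers f g) (fg' : covers f' g') a b :
  f = f' -> g = g' -> htens (p := p) (q := q) fg a b = htens fg' a b.
Proof. by move=> ff gg; subst f' g'; rewrite (eq_irrelevance fg fg'). Qed.

Lemma htens_unfold p q (A B I : finType) (f : emb A I) (g : emb B I)
    (fg : covers f g) a b :
  htens fg a b = dsum_inj (@heis_summand k p q I) (mk_cover2 fg)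
    (tens (sp_map p (corange (erefl (range f))) a)
          (sp_map q (corange (erefl (range g))) b)).
Proof. by rewrite /htens lin_compE tensor_mapE. Qed.

Lemma htens_reindex p q (A B A' B' I : finType) (f : emb A I) (g : emb B I)
    (fg : covers f g) (s : finbij A' A) (t : finbij B' B)
    (fg' : covers (emb_comp f (emb_bij s)) (emb_comp g (emb_bij t))) a b :
  htens fg (sp_map p s a) (sp_map q t b) = htens fg' a b.
Proof.
rewrite [LHS]lin_compE tensor_mapE !sp_map_compE.
exact: (htensE _ (st := mk_cover2 fg)).
Qed.

Lemma htens_map p q (A B I J : finType) (f : emb A I) (g : emb B I)
    (fg : covers f g) (h : finbij I J)
    (fg' : covers (emb_comp (emb_bij h) f) (emb_comp (emb_bij h) g)) a b :
  heis_map p q h (htens fg a b) = htens fg' a b.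
Proof.
rewrite [X in heis_map _ _ _ X]lin_compE tensor_mapE heis_mapE tensor_mapE.
by rewrite !sp_map_compE; apply: (htensE _ (st := cover2_image h (mk_cover2 fg))).
Qed.

(** Naturality of [s] and [t] moves them past the relabellings onto the ranges. *)
Lemma htens_hom p q p' q' (s : sp_hom p p') (t : sp_hom q q') (A B I : finType)
    (f : emb A I) (g : emb B I) (fg : covers f g) a b :
  sp_comp (heisenberg_hom s t) I (htens fg a b)
  = htens fg (sp_comp s A a) (sp_comp t B b).
Proof.
rewrite -[LHS]/(heis_hom_comp s t I _) [X in heis_hom_comp _ _ _ X]lin_compE.
rewrite tensor_mapE heis_hom_compE tensor_mapE.
by rewrite !sp_naturality [RHS]lin_compE tensor_mapE.
Qed.

Lemma htens_sub p q (I : finType) (st : cover2 I) a b :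
  dsum_inj (@heis_summand k p q I) st (tens a b)
  = htens (covers_sub (proj2_sig st)) a b.
Proof.
(* Identity relabellings are inserted to give the vector the shape required by [htensE]. *)
rewrite -[in LHS](_ : sp_map p (finbij_id _) a = a); last by rewrite sp_map_id.
rewrite -[in LHS](_ : sp_map q (finbij_id _) b = b); last by rewrite sp_map_id.
exact: htensE.
Qed.

(** The vectors coming from inclusions of subsets already span, since they are the pure tensors of
    the summands. *)
Lemma htens_ext p q (I : finType) (U : lmodType k) (F G : {linear heis_val p q I -> U}) :
  (forall (A B : finType) (f : emb A I) (g : emb B I) (fg : covers f g) a b,
     F (htens fg a b) = G (htens fg a b)) -> F =1 G.
Proof.
move=> FG; suff -> : F = G by [].
apply: dsum_ind_eq => st v.
rewrite -[LHS](lin_compE F) -[RHS](lin_compE G); congr (GRing.Linear.sort _ _).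
by apply: tensor_ind_eq => a b; rewrite !lin_compE htens_sub; apply: FG.
Qed.

End Generators.

(** * The two bracketings and the sum over triples *)

Section Triples.
Variable k : fieldType.
Implicit Types p q r s : species k.

Section HTens3.
Variables (p q r : species k) (A B C I : finType).
Variables (f : emb A I) (g : emb B I) (h : emb C I) (fgh : covers3 f g h).

Definition htens3 a b c : heis3_val p q r I :=
  dsum_inj (@heis3_summand k p q r I) (exist _ (range f, range g, range h) fgh)
    (tens (sp_map p (corange (erefl (range f))) a)
       (tens (sp_map q (corange (erefl (range g))) b)
             (sp_map r (corange (erefl (range h))) c))).

End HTens3.

Lemma htens3E p q r (A B C I : finType) (f : emb A I) (g : emb B I) (h : emb C I)
    (fgh : covers3 f g h) (uvw : cover3 I) (u : finbij A (subfin (set3_1 uvw)))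
    (v : finbij B (subfin (set3_2 uvw))) (w : finbij C (subfin (set3_3 uvw))) a b c :
  (forall x, subval (u x) = f x) -> (forall x, subval (v x) = g x) ->
  (forall x, subval (w x) = h x) ->
  dsum_inj (@heis3_summand k p q r I) uvw
    (tens (sp_map p u a) (tens (sp_map q v b) (sp_map r w c)))
  = htens3 fgh a b c.
Proof.
case: uvw u v w => [[[U V] W] e] /= u v w uf vg wh.
have fU : range f = U := range_onto uf.
have gV : range g = V := range_onto vg.
have hW : range h = W := range_onto wh.
subst U V W; rewrite (eq_irrelevance e fgh).
have -> : u = corange (erefl (range f)) by apply: finbijP => x; apply: val_inj; apply: uf.
have -> : v = corange (erefl (range g)) by apply: finbijP => x; apply: val_inj; apply: vg.
by have -> : w = corange (erefl (range h)) by apply: finbijP => x; apply: val_inj; apply: wh.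
Qed.

Lemma left_identE p q r (I : finType) (sw : cover2 I)
    (uv : cover2 (subfin (fst_set sw))) a b c :
  left_ident p q r I
    (dsum_inj (@heis_summand k (heisenberg_obj p q) r I) sw
      (tens (dsum_inj (@heis_summand k p q (subfin (fst_set sw))) uv (tens a b)) c))
  = heis3_inj p q r (cover3_left uv)
      (tens (sp_map p (subimage_bij (fst_set uv)) a)
         (tens (sp_map q (subimage_bij (snd_set uv)) b) c)).
Proof.
(* Only the term of [uv] survives: every other one projects the vector of the summand [uv] to a
   different summand. *)
rewrite [LHS]dsum_liftE lin_sumE (bigD1 uv) //= tensor_mapE.
rewrite dsum_proj_inj tensor_assocE !tensor_mapE big1 ?addr0 // => uv' neq.
rewrite tensor_mapE dsum_proj_inj0 1?eq_sym // linear0l.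
by rewrite !linear0.
Qed.

Lemma right_identE p q r (I : finType) (ut : cover2 I)
    (vw : cover2 (subfin (snd_set ut))) a b c :
  right_ident p q r I
    (dsum_inj (@heis_summand k p (heisenberg_obj q r) I) ut
      (tens a (dsum_inj (@heis_summand k q r (subfin (snd_set ut))) vw (tens b c))))
  = heis3_inj p q r (cover3_right vw)
      (tens a
         (tens (sp_map q (subimage_bij (fst_set vw)) b)
               (sp_map r (subimage_bij (snd_set vw)) c))).
Proof.
rewrite [LHS]dsum_liftE lin_sumE (bigD1 vw) //= tensor_mapE.
rewrite dsum_proj_inj !tensor_mapE big1 ?addr0 // => vw' neq.
rewrite tensor_mapE dsum_proj_inj0 1?eq_sym // linear0r.
by rewrite !linear0.
Qed.

Lemma left_ident_htens p q r (A B C S I : finType) (f : emb S I) (h : emb C I)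
    (fh : covers f h) (f' : emb A S) (g' : emb B S) (fg' : covers f' g') a b c
    (fgh : covers3 (emb_comp f f') (emb_comp f g') h) :
  left_ident p q r I
    (@htens k (heisenberg_obj p q) r S C I f h fh (htens fg' a b) c)
  = htens3 fgh a b c.
Proof.
rewrite htens_unfold.
(* The action of [heisenberg_obj p q] is [heis_map], so the inner vector is carried along the
   corange of [f] into the range of [f], where [left_identE] can read off its summand. *)
rewrite [sp_map (heisenberg_obj p q) _ _](htens_map _ (covers_emb _ fg')).
rewrite [X in tens X _]htens_unfold left_identE !sp_map_compE.
exact: (htens3E _ (uvw := exist _ (_, _, _) _)).
Qed.

Lemma right_ident_htens p q r (A B C T I : finType) (f : emb A I) (h : emb T I)
    (fh : covers f h) (g' : emb B T) (h' : emb C T) (gh' : covers g' h') a b c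
    (fgh : covers3 f (emb_comp h g') (emb_comp h h')) :
  right_ident p q r I
    (@htens k p (heisenberg_obj q r) A T I f h fh a (htens gh' b c))
  = htens3 fgh a b c.
Proof.
rewrite htens_unfold.
rewrite [sp_map (heisenberg_obj q r) _ _](htens_map _ (covers_emb _ gh')).
rewrite [X in tens _ X]htens_unfold right_identE !sp_map_compE.
exact: (htens3E _ (uvw := exist _ (_, _, _) _)).
Qed.

Lemma htens3_eq p q r (A B C I : finType) (f f' : emb A I) (g g' : emb B I)
    (h h' : emb C I) (fgh : covers3 f g h) (fgh' : covers3 f' g' h') a b c :
  f = f' -> g = g' -> h = h' ->
  htens3 (p := p) (q := q) (r := r) fgh a b c = htens3 fgh' a b c.
Proof. by move=> ff gg hh; subst f' g' h'; rewrite (eq_irrelevance fgh fgh'). Qed.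

Lemma htens3_sub p q r (I : finType) (uvw : cover3 I) a b c :
  dsum_inj (@heis3_summand k p q r I) uvw (tens a (tens b c))
  = htens3 (covers3_sub uvw) a b c.
Proof.
rewrite -[in LHS](_ : sp_map p (finbij_id _) a = a); last by rewrite sp_map_id.
rewrite -[in LHS](_ : sp_map q (finbij_id _) b = b); last by rewrite sp_map_id.
rewrite -[in LHS](_ : sp_map r (finbij_id _) c = c); last by rewrite sp_map_id.
exact: htens3E.
Qed.

Lemma heis3_ext p q r (I : finType) (U : lmodType k)
    (F G : {linear heis3_val p q r I -> U}) :
  (forall (uvw : cover3 I) a b c,
     F (dsum_inj (@heis3_summand k p q r I) uvw (tens a (tens b c)))
     = G (dsum_inj (@heis3_summand k p q r I) uvw (tens a (tens b c)))) -> F =1 G.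
Proof.
move=> FG; suff -> : F = G by [].
apply: dsum_ind_eq => uvw v.
rewrite -[LHS](lin_compE F) -[RHS](lin_compE G); congr (GRing.Linear.sort _ _).
by apply: tensor3_ext => a b c; rewrite !lin_compE; apply: FG.
Qed.

(** * Inverses of the two identifications *)

Section Inverses.
Variables (p q r : species k) (I : finType).

(** A triple (U, V, W) is sent to the pair (U ∪ V, W) refined by the cover of U ∪ V by U and V. A
    left-bracketed index is determined by its triple in exactly this way. *)
Definition left_inv : {linear heis3_val p q r I -> heis_val (heisenberg_obj p q) r I} :=
  dsum_lift (fun uvw : cover3 I =>
    lin_comp
      (@htens_lin k (heisenberg_obj p q) r _ _ I _ _ (covers_left_sub uvw))
      (lin_comp
        (@tensor_map k _ _
           (sp_val (heisenberg_obj p q) (subfin (set3_1 uvw :|: set3_2 uvw))) _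
           (@htens_lin k p q _ _ _ _ _ (covers_subsetU (set3_1 uvw) (set3_2 uvw)))
           (lin_id _))
        (tensor_unassoc _ _ _))).

Definition right_inv : {linear heis3_val p q r I -> heis_val p (heisenberg_obj q r) I} :=
  dsum_lift (fun uvw : cover3 I =>
    lin_comp
      (@htens_lin k p (heisenberg_obj q r) _ _ I _ _ (covers_right_sub uvw))
      (@tensor_map k _ _ _
           (sp_val (heisenberg_obj q r) (subfin (set3_2 uvw :|: set3_3 uvw)))
           (lin_id _)
           (@htens_lin k q r _ _ _ _ _ (covers_subsetU (set3_2 uvw) (set3_3 uvw))))).

Lemma left_inv_sub (uvw : cover3 I) a b c :
  left_inv (dsum_inj (@heis3_summand k p q r I) uvw (tens a (tens b c)))
  = @htens k (heisenberg_obj p q) r _ _ I _ _ (covers_left_sub uvw)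
      (htens (covers_subsetU (set3_1 uvw) (set3_2 uvw)) a b) c.
Proof.
rewrite [LHS]dsum_liftE lin_compE; congr (GRing.Linear.sort _ _).
by rewrite lin_compE tensor_unassocE tensor_mapE.
Qed.

Lemma right_inv_sub (uvw : cover3 I) a b c :
  right_inv (dsum_inj (@heis3_summand k p q r I) uvw (tens a (tens b c)))
  = @htens k p (heisenberg_obj q r) _ _ I _ _ (covers_right_sub uvw)
      a (htens (covers_subsetU (set3_2 uvw) (set3_3 uvw)) b c).
Proof.
rewrite [LHS]dsum_liftE lin_compE; congr (GRing.Linear.sort _ _).
by rewrite tensor_mapE.
Qed.

Lemma left_invK : cancel left_inv (left_ident p q r I).
Proof.
apply: (heis3_ext (F := lin_comp (left_ident p q r I) left_inv) (G := lin_id _)).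
move=> uvw a b c; rewrite lin_compE left_inv_sub.
rewrite (left_ident_htens _ _ _ _ _ (covers3_left (covers_left_sub uvw) (covers_subsetU _ _))).
by rewrite htens3_sub; apply: htens3_eq; rewrite ?emb_subsetK.
Qed.

Lemma right_invK : cancel right_inv (right_ident p q r I).
Proof.
apply: (heis3_ext (F := lin_comp (right_ident p q r I) right_inv) (G := lin_id _)).
move=> uvw a b c; rewrite lin_compE right_inv_sub.
rewrite (right_ident_htens _ _ _ _ _ (covers3_right (covers_right_sub uvw) (covers_subsetU _ _))).
by rewrite htens3_sub; apply: htens3_eq; rewrite ?emb_subsetK.
Qed.

(** [left_inv] uses one particular middle set, the union of two ranges. Invariance under relabelling
    extends the formula to every [S] covered by A and B. *)
Lemma left_inv_htens3 (A B C S : finType) (f : emb S I) (h : emb C I)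
    (fh : covers f h) (f' : emb A S) (g' : emb B S) (fg' : covers f' g') a b c
    (fgh : covers3 (emb_comp f f') (emb_comp f g') h) :
  left_inv (htens3 fgh a b c)
  = @htens k (heisenberg_obj p q) r S C I f h fh (htens fg' a b) c.
Proof.
(* As A and B cover [S], the range of [f] is this union, and [s] identifies [S] with it. *)
rewrite left_inv_sub; pose s := corange (covers_range f fg').
have fhs : covers (emb_comp (emb_sub _) (emb_bij s))
   (emb_comp (emb_sub (range h)) (emb_bij (corange (erefl (range h))))).
  by rewrite /covers !range_bij !range_sub -covers_range.
transitivity (@htens k (heisenberg_obj p q) r _ _ I _ _ fhs (htens fg' a b) c); last first.
  by apply: htens_eq; apply: embP.
rewrite -(htens_reindex (covers_left_sub (exist _ (_, _, _) fgh))).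
congr (htens _ _ _).
rewrite [RHS](htens_map _ (covers_emb _ fg')).
have E : covers
   (emb_comp (emb_subset (subsetUl (range (emb_comp f f')) (range (emb_comp f g'))))
       (emb_bij (corange (erefl (range (emb_comp f f'))))))
   (emb_comp (emb_subset (subsetUr (range (emb_comp f f')) (range (emb_comp f g'))))
       (emb_bij (corange (erefl (range (emb_comp f g')))))).
  by rewrite /covers !range_bij; apply: covers_subsetU.
rewrite (htens_reindex (covers_subsetU _ _) E).
by apply: htens_eq; apply: embP => x; apply: val_inj.
Qed.

Lemma right_inv_htens3 (A B C T : finType) (f : emb A I) (h : emb T I)
    (fh : covers f h) (g' : emb B T) (h' : emb C T) (gh' : covers g' h') a b c
    (fgh : covers3 f (emb_comp h g') (emb_comp h h')) :
  right_inv (htens3 fgh a b c)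
  = @htens k p (heisenberg_obj q r) A T I f h fh a (htens gh' b c).
Proof.
rewrite right_inv_sub; pose s := corange (covers_range h gh').
have fhs : covers (emb_comp (emb_sub (range f)) (emb_bij (corange (erefl (range f)))))
   (emb_comp (emb_sub _) (emb_bij s)).
  by rewrite /covers !range_bij !range_sub -covers_range.
transitivity (@htens k p (heisenberg_obj q r) _ _ I _ _ fhs a (htens gh' b c)); last first.
  by apply: htens_eq; apply: embP.
rewrite -(htens_reindex (covers_right_sub (exist _ (_, _, _) fgh))).
congr (htens _ _ _).
rewrite [RHS](htens_map _ (covers_emb _ gh')).
have E : covers
   (emb_comp (emb_subset (subsetUl (range (emb_comp h g')) (range (emb_comp h h'))))
       (emb_bij (corange (erefl (range (emb_comp h g'))))))
   (emb_comp (emb_subset (subsetUr (range (emb_comp h g')) (range (emb_comp h h'))))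
       (emb_bij (corange (erefl (range (emb_comp h h')))))).
  by rewrite /covers !range_bij; apply: covers_subsetU.
rewrite (htens_reindex (covers_subsetU _ _) E).
by apply: htens_eq; apply: embP => x; apply: val_inj.
Qed.

End Inverses.
End Triples.

(** * The associator *)

Section Associator.
Variable k : fieldType.
Implicit Types p q r s : species k.

Section Ext.
Variables (p q r : species k) (I : finType) (U : lmodType k).

(** [htens_ext] is applied to the outer product, and then to the inner one with [c] held fixed
    through [htensl]. *)
Lemma htens_extl (F G : {linear heis_val (heisenberg_obj p q) r I -> U}) :
  (forall (A B C S : finType) (f : emb S I) (h : emb C I) (fh : covers f h)
     (f' : emb A S) (g' : emb B S) (fg' : covers f' g') a b c,
     F (@htens k (heisenberg_obj p q) r S C I f h fh (htens fg' a b) c)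
     = G (@htens k (heisenberg_obj p q) r S C I f h fh (htens fg' a b) c)) ->
  F =1 G.
Proof.
move=> FG; apply: htens_ext => S C f h fh x c.
apply: (htens_ext (p := p) (q := q)
  (F := lin_comp F (@htensl k (heisenberg_obj p q) r _ _ _ _ _ fh c))
  (G := lin_comp G (@htensl k (heisenberg_obj p q) r _ _ _ _ _ fh c))).
by move=> A B f' g' fg' a b; apply: FG.
Qed.

Lemma htens_extr (F G : {linear heis_val p (heisenberg_obj q r) I -> U}) :
  (forall (A B C T : finType) (f : emb A I) (h : emb T I) (fh : covers f h)
     (g' : emb B T) (h' : emb C T) (gh' : covers g' h') a b c,
     F (@htens k p (heisenberg_obj q r) A T I f h fh a (htens gh' b c))
     = G (@htens k p (heisenberg_obj q r) A T I f h fh a (htens gh' b c))) ->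
  F =1 G.
Proof.
move=> FG; apply: htens_ext => A T f h fh a x.
apply: (htens_ext (p := q) (q := r)
  (F := lin_comp F (@htensr k p (heisenberg_obj q r) _ _ _ _ _ fh a))
  (G := lin_comp G (@htensr k p (heisenberg_obj q r) _ _ _ _ _ fh a))).
by move=> B C g' h' gh' b c; apply: FG.
Qed.

End Ext.

Section Assoc.
Variables p q r : species k.

Lemma left_identK I : cancel (left_ident p q r I) (left_inv p q r I).
Proof.
apply: (htens_extl (F := lin_comp (left_inv p q r I) (left_ident p q r I))
  (G := lin_id _)) => A B C S f h fh f' g' fg' a b c.
rewrite lin_compE (left_ident_htens _ _ _ _ _ (covers3_left fh fg')).
exact: left_inv_htens3.
Qed.

Lemma right_identK I : cancel (right_ident p q r I) (right_inv p q r I).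
Proof.
apply: (htens_extr (F := lin_comp (right_inv p q r I) (right_ident p q r I))
  (G := lin_id _)) => A B C T f h fh g' h' gh' a b c.
rewrite lin_compE (right_ident_htens _ _ _ _ _ (covers3_right fh gh')).
exact: right_inv_htens3.
Qed.

Definition assoc_comp I :
    {linear heis_val (heisenberg_obj p q) r I -> heis_val p (heisenberg_obj q r) I} :=
  lin_comp (right_inv p q r I) (left_ident p q r I).

Definition assoc_inv_comp I :
    {linear heis_val p (heisenberg_obj q r) I -> heis_val (heisenberg_obj p q) r I} :=
  lin_comp (left_inv p q r I) (right_ident p q r I).

(** Both vectors have the same image in the sum over triples, which retains only the embeddings of
    A, B and C in [I]. Hence [T] and [l] may be any factorisation. Stating the compatibilities as
    equations lets composites be bracketed freely. *)
Lemma assoc_htens (A B C S T I : finType) (f : emb S I) (h : emb C I)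
    (fh : covers f h) (f' : emb A S) (g' : emb B S) (fg' : covers f' g') a b c
    (f0 : emb A I) (l : emb T I) (fl : covers f0 l) (g : emb B T) (h' : emb C T)
    (gh' : covers g h') :
  f0 = emb_comp f f' -> emb_comp f g' = emb_comp l g -> h = emb_comp l h' ->
  assoc_comp I (@htens k (heisenberg_obj p q) r S C I f h fh (htens fg' a b) c)
  = @htens k p (heisenberg_obj q r) A T I f0 l fl a (htens gh' b c).
Proof.
move=> fE gE hE; rewrite lin_compE (left_ident_htens _ _ _ _ _ (covers3_left fh fg')).
rewrite -(right_inv_htens3 _ _ _ _ _ (covers3_right fl gh')).
by congr (GRing.Linear.sort _ _); apply: htens3_eq.
Qed.

Lemma assoc_comp_natural (I J : finType) (f : finbij I J) x :
  assoc_comp J (heis_map (heisenberg_obj p q) r f x)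
  = heis_map p (heisenberg_obj q r) f (assoc_comp I x).
Proof.
apply: (htens_extl
  (F := lin_comp (assoc_comp J) (heis_map (heisenberg_obj p q) r f))
  (G := lin_comp (heis_map p (heisenberg_obj q r) f) (assoc_comp I))).
move=> {x} A B C S f0 h fh f' g' fg' a b c; rewrite lin_compE [RHS]lin_compE.
have [T [l [g [h' [gE hE gh']]]]] := factor_cover (emb_comp f0 g') h.
have fl := covers_assocr fh fg' gh' gE hE.
rewrite (assoc_htens fh fg' a b c fl gh' erefl gE hE).
rewrite (htens_map _ (covers_emb f fh)) (htens_map _ (covers_emb f fl)).
(* The set [T] chosen over [I] also serves over [J], after composing its embedding with [f]. *)
apply: assoc_htens; rewrite ?emb_compA //.
  by rewrite -emb_compA gE emb_compA.
by rewrite hE emb_compA.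
Qed.

Definition assoc_hom : sp_hom (heisenberg_obj (heisenberg_obj p q) r)
                              (heisenberg_obj p (heisenberg_obj q r)) :=
  mk_sp_hom (p := heisenberg_obj (heisenberg_obj p q) r)
    (q := heisenberg_obj p (heisenberg_obj q r)) assoc_comp_natural.

End Assoc.

(* The inverses of the components are automatically natural. *)
Lemma sp_iso p q (s : sp_hom p q) (t : forall I, {linear sp_val q I -> sp_val p I}) :
  (forall I, cancel (sp_comp s I) (t I)) -> (forall I, cancel (t I) (sp_comp s I)) ->
  is_iso (C := SpCat k) s.
Proof.
move=> st ts.
have tn (I J : finType) (f : finbij I J) x : t J (sp_map q f x) = sp_map p f (t I x).
  by rewrite -{1}[x]ts -sp_naturality st.
exists (mk_sp_hom tn); split; apply: sp_homP => I x; [exact: st|exact: ts].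
Qed.

Lemma assoc_iso p q r : is_iso (C := SpCat k) (assoc_hom p q r).
Proof.
apply: (@sp_iso _ _ (assoc_hom p q r) (assoc_inv_comp p q r)) => I.
  exact: (can_comp (right_invK (p := p) (q := q) (r := r) (I := I))
                   (left_identK (p := p) (q := q) (r := r) (I := I))).
exact: (can_comp (left_invK (p := p) (q := q) (r := r) (I := I))
                 (right_identK (p := p) (q := q) (r := r) (I := I))).
Qed.

Lemma nat_compE p q r (t : sp_hom q r) (s : sp_hom p q) I x :
  sp_comp (nat_comp t s) I x = sp_comp t I (sp_comp s I x).
Proof. by []. Qed.

Lemma assoc_hom_htens p q r (A B C S T I : finType) (f : emb S I) (h : emb C I)
    (fh : covers f h) (f' : emb A S) (g' : emb B S) (fg' : covers f' g') a b c
    (f0 : emb A I) (l : emb T I) (fl : covers f0 l) (g : emb B T) (h' : emb C T)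
    (gh' : covers g h') :
  f0 = emb_comp f f' -> emb_comp f g' = emb_comp l g -> h = emb_comp l h' ->
  sp_comp (assoc_hom p q r) I
    (@htens k (heisenberg_obj p q) r S C I f h fh (htens fg' a b) c)
  = @htens k p (heisenberg_obj q r) A T I f0 l fl a (htens gh' b c).
Proof. exact: assoc_htens. Qed.

Lemma assoc_natural p q r p' q' r' (s : sp_hom p p') (t : sp_hom q q')
    (u : sp_hom r r') :
  nat_comp (assoc_hom p' q' r') (heisenberg_hom (heisenberg_hom s t) u)
  = nat_comp (heisenberg_hom s (heisenberg_hom t u)) (assoc_hom p q r).
Proof.
apply: sp_homP => I.
apply: htens_extl => A B C S f h fh f' g' fg' a b c.
have [T [l [g [h' [gE hE gh']]]]] := factor_cover (emb_comp f g') h.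
have fl := covers_assocr fh fg' gh' gE hE.
rewrite nat_compE [RHS]nat_compE (assoc_hom_htens fh fg' a b c fl gh' erefl gE hE).
rewrite (htens_hom (heisenberg_hom s t) u) (htens_hom s t).
rewrite (htens_hom s (heisenberg_hom t u)) (htens_hom t u).
exact: assoc_hom_htens.
Qed.

(** Both routes are evaluated on ((a ⊗ b) ⊗ c) ⊗ d. The middle sets at each associator are chosen so
    that both end at the same a ⊗ (b ⊗ (c ⊗ d)), formed over T1 and T2. *)
Lemma assoc_pentagon p q r s :
  nat_comp (assoc_hom p q (heisenberg_obj r s)) (assoc_hom (heisenberg_obj p q) r s)
  = nat_comp (nat_comp (heisenberg_hom (nat_id p) (assoc_hom q r s))
                (assoc_hom p (heisenberg_obj q r) s))
      (heisenberg_hom (assoc_hom p q r) (nat_id s)).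
Proof.
apply: sp_homP => I.
apply: htens_extl => S2 W X S1 f n fn f1 m fm1 x c d.
set L := nat_comp _ _; set R := nat_comp _ _.
(* [htens_extl] opens two levels of nesting. [pre] makes the rest linear in [x], so that the third
   level can be opened as well. *)
pose pre := lin_comp (@htensl k (heisenberg_obj (heisenberg_obj p q) r) s S1 X I f n fn d)
  (@htensl k (heisenberg_obj p q) r S2 W S1 f1 m fm1 c).
apply: (htens_ext (p := p) (q := q)
   (F := lin_comp (sp_comp L I) pre) (G := lin_comp (sp_comp R I) pre)).
move=> {x} U V f2 g fg2 a b.
(* With all sets viewed in [I]: T2 = W ∪ X, T1 = V ∪ W ∪ X and T' = V ∪ W. *)
have [T2 [k1 [m1 [n1 [mE nE mn1]]]]] := factor_cover (emb_comp f m) n.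
have fk1 := covers_assocr fn fm1 mn1 mE nE.
have [T1 [k2 [g2 [j2 [gE kE gj2]]]]] := factor_cover (emb_comp (emb_comp f f1) g) k1.
have fk2 := covers_assocr fk1 fg2 gj2 gE kE.
have [T' [k3 [g3 [m3 [g1E mE3 gm3]]]]] := factor_cover (emb_comp f1 g) m.
have fk3 := covers_assocr fm1 fg2 gm3 g1E mE3.
(* [g4] is the inclusion of T' in T1, that is of V ∪ W in V ∪ W ∪ X. The route through three
   associators needs it for the last one, which takes place inside T1. *)
have [||g4 [g4E g43 g4m]] := @covers_lift _ _ _ _ _ (emb_comp f k3) k2 _ _ g2
  (emb_comp j2 m1) gm3.
- by rewrite -emb_compA -g1E emb_compA.
- by rewrite -emb_compA -mE3 mE kE emb_compA.
have n4E : n = emb_comp k2 (emb_comp j2 n1) by rewrite emb_compA -kE.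
have gn4 : covers g4 (emb_comp j2 n1).
  apply/coversP => y; have /coversP /(_ y) [[v ->]|[t ->]] := gj2.
    by left; exists (g3 v); rewrite -g43.
  have /coversP /(_ t) [[w ->]|[z ->]] := mn1; last by right; exists z.
  by left; exists (m3 w); apply/esym; apply: (congr1 (fun e : emb _ _ => e w) g4m).
have preE : pre (htens fg2 a b) =
  @htens k (heisenberg_obj (heisenberg_obj p q) r) s _ _ _ _ _ fn
    (@htens k (heisenberg_obj p q) r _ _ _ _ _ fm1 (htens fg2 a b) c) d by [].
transitivity (@htens k p (heisenberg_obj q (heisenberg_obj r s)) _ _ I _ _ fk2 a
   (@htens k q (heisenberg_obj r s) _ _ _ _ _ gj2 b (htens mn1 c d))).
  rewrite lin_compE preE nat_compE.
  rewrite (@assoc_hom_htens (heisenberg_obj p q) r s _ _ _ _ _ _ _ _ fn _ _ fm1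
    (htens fg2 a b) c d _ _ fk1 _ _ mn1 erefl mE nE).
  exact: assoc_hom_htens.
rewrite [RHS]lin_compE preE [RHS]nat_compE.
rewrite (htens_hom (assoc_hom p q r) (nat_id s)).
rewrite (assoc_hom_htens fm1 fg2 a b c fk3 gm3 erefl g1E mE3) nat_compE.
rewrite (@assoc_hom_htens p (heisenberg_obj q r) s _ _ _ _ _ _ _ _ fn _ _ fk3 a
  (htens gm3 b c) d _ _ fk2 _ _ gn4 _ g4E n4E); last by rewrite emb_compA.
rewrite (htens_hom (nat_id p) (assoc_hom q r s)).
by congr (htens _ _ _); apply/esym/assoc_hom_htens.
Qed.

End Associator.

(** * Units *)

Section Unit.
Variable k : fieldType.
Implicit Types p q : species k.
Local Notation one := (one_species k).

(** Matching on the Boolean makes [one_val] reduce. The resulting [one_eps] is the coordinate of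
    1[A] in k, injective for every A, so vectors of 1[A] can be compared as scalars. *)
Definition one_eps_val (b : bool) : {linear one_val k b -> k^o} :=
  match b with true => lin_id k^o | false => lin_zero _ _ end.

Definition one_eps (A : finType) : {linear sp_val one A -> k^o} :=
  one_eps_val (#|A| == 0).

Lemma one_eps0 (A : finType) (v : sp_val one A) : (#|A| == 0) = false -> one_eps A v = 0.
Proof. by rewrite /one_eps; move: v; rewrite /sp_val /=; case: (_ == _). Qed.

Lemma one_eps_map (A B : finType) (f : finbij A B) v :
  one_eps B (sp_map one f v) = one_eps A v.
Proof.
rewrite /one_eps /sp_map /=; move: (finbij_card0 f) v; rewrite /sp_val /=.
by move: (#|A| == 0) (#|B| == 0) => a b e; subst b.
Qed.

Lemma one_eps_inj (A : finType) : injective (one_eps A).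
Proof.
rewrite /one_eps /sp_val /=; case: (_ == _) => //= x y _.
by rewrite (matrix.thinmx0 x) (matrix.thinmx0 y).
Qed.

Lemma one_eps_surj (A : finType) : #|A| == 0 -> exists v, one_eps A v = 1.
Proof.
rewrite /one_eps /sp_val /=; case: (_ == _) => //= _.
by exists (1 : k^o).
Qed.

Lemma void_card0 : #|(void : finType)| == 0.
Proof. by rewrite card_void. Qed.

Definition one_pt : sp_val one void := projT1 (cid (one_eps_surj void_card0)).

Lemma one_eps_pt : one_eps void one_pt = 1.
Proof. exact: (projT2 (cid (one_eps_surj void_card0))). Qed.

Lemma one_ptE (v : sp_val one void) : v = one_eps void v *: one_pt.
Proof. by apply: one_eps_inj; rewrite linearZ /= one_eps_pt [RHS]mulr1. Qed.

(* The junk value 0 at non-surjective embeddings is harmless: [left_unit_comp]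
   multiplies it by a value of [one_eps] on a nonempty set, which is 0. *)
Definition sp_ext p (B I : finType) (g : emb B I) : {linear sp_val p B -> sp_val p I} :=
  match pselect (bijective g) with
  | left gB => sp_map p (FinBij gB)
  | right _ => lin_zero _ _
  end.

Lemma sp_ext_bij p (B I : finType) (s : finbij B I) : sp_ext p (emb_bij s) = sp_map p s.
Proof.
rewrite /sp_ext; case: pselect => [gB|[]]; last exact: finbij_bij.
by congr sp_map; apply: finbijP.
Qed.

Definition left_unit_comp p (I : finType) : {linear heis_val one p I -> sp_val p I} :=
  dsum_lift (fun st : cover2 I =>
    tensor_scale (one_eps (subfin (fst_set st))) (sp_ext p (emb_sub (snd_set st)))).

(** For nonempty A both sides vanish. For empty A, [g] and the inclusion of its range are both
    bijections onto [I], and the two transports of [x] agree. *)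
Lemma left_unit_htens p (A B I : finType) (f : emb A I) (g : emb B I)
    (fg : covers f g) v x :
  left_unit_comp p I (htens fg v x) = one_eps A v *: sp_ext p g x.
Proof.
rewrite htens_unfold [LHS]dsum_liftE tensor_scaleE one_eps_map.
have [A0|A0] := boolP (#|A| == 0); last by rewrite one_eps0 ?scale0r //; apply: negbTE.
congr (_ *: _); have [s sE] := covers_card0 fg (eqP A0).
have rf0 : #|subfin (range f)| = 0.
  by rewrite -(eqP A0) (bij_eq_card (corange_bij (erefl (range f)))).
have [t tE] := covers_card0 (covers_sub (proj2_sig (mk_cover2 fg))) rf0.
rewrite /= in tE; rewrite [emb_sub _]tE [in RHS]sE !sp_ext_bij sp_map_compE.
congr (GRing.Linear.sort (sp_map p _) x); apply: finbijP => y.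
by rewrite -[LHS]/(emb_bij t _) -tE -[RHS]/(emb_bij s y) -sE.
Qed.

Lemma left_unit_bij p (A B I : finType) (f : emb A I) (g : emb B I)
    (fg : covers f g) (s : finbij B I) v x :
  g = emb_bij s -> left_unit_comp p I (htens fg v x) = one_eps A v *: sp_map p s x.
Proof. by move=> gE; rewrite left_unit_htens gE sp_ext_bij. Qed.

(* [one[A]] vanishes unless [A] is empty, and then [g] is onto by [fg]. *)
Lemma one_htens_ext p (I : finType) (U : lmodType k) (F G : {linear heis_val one p I -> U}) :
  (forall (A B : finType) (f : emb A I) (g : emb B I) (fg : covers f g)
     (s : finbij B I) v x, #|A| = 0 -> g = emb_bij s ->
     F (htens fg v x) = G (htens fg v x)) -> F =1 G.
Proof.
move=> FG; apply: htens_ext => A B f g fg v x.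
have [A0|A0] := boolP (#|A| == 0).
  by have [s sE] := covers_card0 fg (eqP A0); apply: (FG _ _ _ _ _ s); rewrite ?(eqP A0).
have -> : v = 0 by apply: one_eps_inj; rewrite linear0 one_eps0 //; apply: negbTE.
have -> : htens fg (0 : sp_val one A) x = 0
  by rewrite -[LHS]/(htensl one fg x 0) linear0.
by rewrite !linear0.
Qed.

Lemma left_unit_natural p (I J : finType) (h : finbij I J) x :
  left_unit_comp p J (heis_map one p h x) = sp_map p h (left_unit_comp p I x).
Proof.
apply: (one_htens_ext (F := lin_comp (left_unit_comp p J) (heis_map one p h))
  (G := lin_comp (sp_map p h) (left_unit_comp p I))).
move=> {x} A B f g fg s v x A0 gE; rewrite lin_compE [RHS]lin_compE.
rewrite (htens_map _ (covers_emb h fg)) (left_unit_bij _ _ _ gE).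
rewrite (left_unit_bij _ (s := finbij_comp h s)); last by rewrite gE; apply: embP.
by rewrite sp_map_comp linearZ.
Qed.

Definition left_unit p : sp_hom (heisenberg_obj one p) p :=
  mk_sp_hom (p := heisenberg_obj one p) (@left_unit_natural p).

Definition left_unit_inv p (I : finType) : {linear sp_val p I -> heis_val one p I} :=
  htensr p (covers_void I) one_pt.

Lemma left_unit_iso p : is_iso (C := SpCat k) (left_unit p).
Proof.
apply: (@sp_iso _ _ _ (left_unit p) (left_unit_inv p)) => I x; last first.
  rewrite [LHS](left_unit_bij _ (s := finbij_id I)); last exact: embP.
  by rewrite one_eps_pt scale1r sp_map_id.
apply: (one_htens_ext (F := lin_comp (left_unit_inv p I) (left_unit_comp p I))
  (G := lin_id _)).
move=> {x} A B f g fg s v x A0 gE; rewrite lin_compE (left_unit_bij _ _ _ gE) linearZ.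
(* Relabelling the empty A as [void] turns [v] into its coordinate times [one_pt]. *)
have [t _] := card0_void A0.
rewrite -(one_eps_map t) -[RHS]/(htens fg v x).
have ts : covers (emb_comp (emb_void I) (emb_bij t)) (emb_comp (emb_id I) (emb_bij s)).
  by rewrite /covers !range_bij; apply: covers_void.
transitivity (htens ts v x).
  rewrite -(htens_reindex (covers_void I)) [in RHS](one_ptE (sp_map one t v)).
  by rewrite [RHS](linearZ_LR (htensl one (covers_void I) _)).
apply: htens_eq; apply: embP => a; last by rewrite gE.
by have := card0_eq A0 a.
Qed.

Lemma left_unit_natural_hom p q (s : sp_hom p q) :
  nat_comp (left_unit q) (heisenberg_hom (nat_id one) s) = nat_comp s (left_unit p).
Proof.
apply: sp_homP => I; apply: one_htens_ext => A B f g fg t v x _ gE.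
rewrite nat_compE [RHS]nat_compE (htens_hom (nat_id one) s).
rewrite [LHS](left_unit_bij _ _ _ gE) [X in _ = _ X](left_unit_bij _ _ _ gE).
by rewrite linearZ sp_naturality.
Qed.

(** * The symmetry of the product and the right unitor *)

Section Braid.
Variables p q : species k.

Definition braid_comp (I : finType) : {linear heis_val p q I -> heis_val q p I} :=
  dsum_lift (fun st : cover2 I =>
    lin_comp (htens_lin q p (coversC (covers_sub (proj2_sig st)))) (tensor_swap _ _)).

Lemma braid_htens (A B I : finType) (f : emb A I) (g : emb B I)
    (fg : covers f g) (gf : covers g f) a b :
  braid_comp I (htens fg a b) = htens gf b a.
Proof.
rewrite htens_unfold [LHS]dsum_liftE lin_compE tensor_swapE -[LHS]/(htens _ _ _).
have gf' : covers (emb_comp (emb_sub (range g)) (emb_bij (corange (erefl (range g)))))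
                  (emb_comp (emb_sub (range f)) (emb_bij (corange (erefl (range f))))).
  by rewrite /covers !range_bij !range_sub; apply: coversC.
by rewrite (htens_reindex _ gf'); apply: htens_eq; apply: embP.
Qed.

Lemma braid_natural (I J : finType) (h : finbij I J) x :
  braid_comp J (heis_map p q h x) = heis_map q p h (braid_comp I x).
Proof.
apply: (htens_ext (F := lin_comp (braid_comp J) (heis_map p q h))
  (G := lin_comp (heis_map q p h) (braid_comp I))).
move=> {x} A B f g fg a b; rewrite lin_compE [RHS]lin_compE.
rewrite (braid_htens fg (coversC fg)) (htens_map _ (covers_emb h fg)).
rewrite (htens_map _ (covers_emb h (coversC fg))).
exact: braid_htens.
Qed.

Definition braid : sp_hom (heisenberg_obj p q) (heisenberg_obj q p) :=
  mk_sp_hom (p := heisenberg_obj p q) (q := heisenberg_obj q p) braid_natural.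

End Braid.

Lemma braidK p q I : cancel (braid_comp p q I) (braid_comp q p I).
Proof.
apply: (htens_ext (F := lin_comp (braid_comp q p I) (braid_comp p q I)) (G := lin_id _)).
move=> A B f g fg a b; rewrite lin_compE (braid_htens fg (coversC fg)).
exact: braid_htens.
Qed.

Lemma braid_natural_hom p q p' q' (s : sp_hom p p') (t : sp_hom q q') :
  nat_comp (braid p' q') (heisenberg_hom s t) = nat_comp (heisenberg_hom t s) (braid p q).
Proof.
apply: sp_homP => I; apply: htens_ext => A B f g fg a b.
rewrite nat_compE [RHS]nat_compE (htens_hom s t).
rewrite [X in _ = _ X](braid_htens fg (coversC fg)) (htens_hom t s).
exact: braid_htens.
Qed.

Definition right_unit p : sp_hom (heisenberg_obj p one) p :=
  nat_comp (left_unit p) (braid p one).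

Lemma right_unit_iso p : is_iso (C := SpCat k) (right_unit p).
Proof.
apply: (is_iso_comp (left_unit_iso p)).
apply: (@sp_iso _ _ _ (braid p one) (braid_comp one p)) => I; exact: braidK.
Qed.

Lemma right_unit_natural_hom p q (s : sp_hom p q) :
  nat_comp (right_unit q) (heisenberg_hom s (nat_id one)) = nat_comp s (right_unit p).
Proof.
transitivity (nat_comp (left_unit q) (nat_comp (braid q one) (heisenberg_hom s (nat_id one)))).
  exact/esym/(compcA (c := SpCat k)).
rewrite braid_natural_hom; transitivity (nat_comp (nat_comp s (left_unit p)) (braid p one)).
  by rewrite -left_unit_natural_hom; apply: (compcA (c := SpCat k)).
exact/esym/(compcA (c := SpCat k)).
Qed.

(** Both sides carry the scalar [one_eps E v], so E may be taken empty. Then A → S and C → T are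
    bijections, and both sides are a ⊗ y for the same embeddings of A and C in [I]. *)
Lemma assoc_triangle p q :
  nat_comp (heisenberg_hom (nat_id p) (left_unit q)) (assoc_hom p one q)
  = heisenberg_hom (right_unit p) (nat_id q).
Proof.
apply: sp_homP => I; apply: htens_extl => A E C S f h fh f' g' fg' a v y.
have [T [l [g [h' [gE hE gh']]]]] := factor_cover (emb_comp f g') h.
have fl := covers_assocr fh fg' gh' gE hE.
rewrite nat_compE (assoc_hom_htens fh fg' a v y fl gh' erefl gE hE).
rewrite (htens_hom (nat_id p) (left_unit q)).
rewrite [RHS](htens_hom (right_unit p) (nat_id q)).
have -> : sp_comp (left_unit q) T (htens gh' v y) = one_eps E v *: sp_ext q h' y.
  exact: left_unit_htens.
have -> : sp_comp (right_unit p) S (htens fg' a v) = one_eps E v *: sp_ext p f' a.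
  rewrite [LHS]lin_compE (braid_htens fg' (coversC fg')).
  exact: left_unit_htens.
rewrite [LHS](linearZ_LR (htensr q fl _)) [RHS](linearZ_LR (htensl p fh _)) /=.
have /orP [E0|E0] := orbN (#|E| == 0); last by rewrite one_eps0 ?scale0r //; apply: negbTE.
congr (_ *: _).
have [s sE] := covers_card0 gh' (eqP E0).
have [t tE] := covers_card0 (coversC fg') (eqP E0).
have -> : sp_ext q h' y = sp_map q s y by rewrite sE sp_ext_bij.
have -> : sp_ext p f' a = sp_map p t a by rewrite tE sp_ext_bij.
have fh' : covers (emb_comp f (emb_bij t)) (emb_comp h (emb_bij (finbij_id C))).
  by rewrite /covers !range_bij.
have fl' : covers (emb_comp (emb_comp f f') (emb_bij (finbij_id A))) (emb_comp l (emb_bij s)).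
  by rewrite /covers !range_bij.
have idE (r : species k) (D : finType) (z : sp_val r D) : sp_map r (finbij_id D) z = z.
  by rewrite sp_map_id.
rewrite -[in LHS](idE p A a) -[in RHS](idE q C y).
rewrite (htens_reindex fl fl') (htens_reindex fh fh').
by apply: htens_eq; rewrite ?hE -?tE -?sE; apply: embP.
Qed.

(** * Additivity and assembly of the structure *)

Lemma heisenberg_addl p p' q (s t : sp_hom p p') :
  heisenberg_hom (sp_add_hom s t) (nat_id q)
  = sp_add_hom (heisenberg_hom s (nat_id q)) (heisenberg_hom t (nat_id q)).
Proof.
apply: sp_homP => I; apply: htens_ext => A B f g fg a b.
rewrite (htens_hom (sp_add_hom s t) (nat_id q)).
rewrite -[RHS]/(sp_comp (heisenberg_hom s (nat_id q)) I _
                + sp_comp (heisenberg_hom t (nat_id q)) I _).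
rewrite (htens_hom s (nat_id q)) (htens_hom t (nat_id q)).
exact: (linearD (htensl _ fg _)).
Qed.

Lemma heisenberg_addr p q q' (s t : sp_hom q q') :
  heisenberg_hom (nat_id p) (sp_add_hom s t)
  = sp_add_hom (heisenberg_hom (nat_id p) s) (heisenberg_hom (nat_id p) t).
Proof.
apply: sp_homP => I; apply: htens_ext => A B f g fg a b.
rewrite (htens_hom (nat_id p) (sp_add_hom s t)).
rewrite -[RHS]/(sp_comp (heisenberg_hom (nat_id p) s) I _
                + sp_comp (heisenberg_hom (nat_id p) t) I _).
rewrite (htens_hom (nat_id p) s) (htens_hom (nat_id p) t).
exact: (linearD (htensr _ fg _)).
Qed.

Definition heisenberg_monoidal : monoidal_structure (heisenberg k) one :=
  @MonoidalStructure (SpCat k) (heisenberg k) one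
    (@assoc_hom k) left_unit right_unit
    (@assoc_iso k) left_unit_iso right_unit_iso (@assoc_natural k)
    left_unit_natural_hom right_unit_natural_hom (@assoc_pentagon k) assoc_triangle.

Definition heisenberg_additive_monoidal :
    additive_monoidal_structure (heisenberg k) one :=
  @AdditiveMonoidal (SpCat k) (heisenberg k) one heisenberg_monoidal
    heisenberg_addl heisenberg_addr.

End Unit.

Theorem theorem2p3 (k : fieldType) (char0 : [pchar k] =i pred0) :
  exists M : additive_monoidal_structure (heisenberg k) (one_species k),
    natural_associativity (@associator (SpCat k) (heisenberg k) (one_species k) M).
Proof.
exists (heisenberg_additive_monoidal k) => p q r I; split.
- exact: Bijective (left_identK (I := I)) (left_invK (I := I)).
- exact: Bijective (right_identK (I := I)) (right_invK (I := I)).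
(* The associator is by construction [right_inv] after [left_ident]. *)
- by move=> x; apply: right_invK.
Qed.
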